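(* Let the system $(A,B,C,D)$ be externally symmetric with signature matrix $\Sigma_e$, let $Q\succeq0$, $R\succ0$, $t_f\in(0,\infty)$, $x_0\in\mathbb{R}^n$ and $u_0\in\mathcal{L}_\infty^m(0,t_f)$. Suppose that $$\Vert Q\Vert_\infty\,\Vert G\Vert_{\rm pk}^2\,\Vert R^{-1}\Vert_\infty<1.$$ Then for every $\alpha\in(0,1]$ the sequence generated by $u_{k+1}=(1-\alpha)u_k+\alpha\mathcal{T}(u_k)$, $k=0,1,2,\dots$, satisfies $$\lim_{k\to+\infty}\Vert u_k-u^\star\Vert_{\infty,t_f}=0,$$ where $u^\star$ is the optimal solution of the problem of minimizing $J(x_0,u)$ over $u\in\mathcal{L}_\infty^m(0,t_f)$.
   Context: A prime denotes transpose. The system is $\frac{d}{dt}x=Ax+Bu$, $y=Cx+Du$ with $x(t)\in\mathbb{R}^n$, $u(t),y(t)\in\mathbb{R}^m$, real matrices $A,B,C,D$, and transfer function $G(s)=C(sI-A)^{-1}B+D$. A signature matrix is a diagonal matrix with diagonal entries in $\{-1,+1\}$. The system is externally symmetric with signature matrix $\Sigma_e\in\mathbb{R}^{m\times m}$ if $\Sigma_eG(s)'=G(s)\Sigma_e$. The cost is $J(x_0,u)=\frac12\int_0^{t_f}y'(t)Qy(t)+u'(t)Ru(t)\,dt$, where $x,u,y$ satisfy the system equations with $x(0)=x_0$; $Q,R\in\mathbb{R}^{m\times m}$ are symmetric. $\mathcal{L}_\infty^m(0,t_f)$ is the space of (classes of a.e. equal) measurable essentially bounded $u:[0,t_f]\to\mathbb{R}^m$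 with $\Vert u\Vert_{\infty,t_f}=\operatorname{ess\,sup}_{t}\Vert u(t)\Vert_\infty$. For matrices $\Vert\cdot\Vert_\infty$ is the induced $\infty$-norm (maximum absolute row sum). The peak-to-peak gain is $\Vert G\Vert_{\rm pk}=\bigl\Vert\,|D|+\int_0^\infty|C\exp(At)B|\,dt\bigr\Vert_\infty$ with entrywise absolute values; the hypothesis includes $\Vert G\Vert_{\rm pk}<\infty$. Define $\mathcal{J}u(t)=u(t_f-t)$, $\mathcal{G}u(t)=\int_0^tC\exp(A(t-\tau))Bu(\tau)d\tau+Du(t)$, $d_{x_0}(t)=C\exp(At)x_0$ for $t\in[0,t_f]$, with matrices acting pointwise on signals, and $$\mathcal{T}(u)=-R^{-1}\Sigma_e\mathcal{J}\mathcal{G}\Sigma_eQ\mathcal{J}(\mathcal{G}u+d_{x_0}).$$ *)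

(* Defs.v *)
From HB Require Import structures.
From mathcomp Require Import all_boot all_order all_algebra.
From mathcomp Require Import all_classical all_reals all_analysis.
From mathcomp Require Import ess_sup_inf complex.

Set Implicit Arguments.
Unset Strict Implicit.
Unset Printing Implicit Defensive.

Import Order.TTheory GRing.Theory Num.Theory.
Import numFieldNormedType.Exports.

Local Open Scope classical_set_scope.
Local Open Scope ring_scope.

(* Throughout, [K] is the field of real numbers and signals on [0, tf] are
   represented by functions on [K] of which only the values on [0, tf] matter;
   two signals are identified when they are a.e. equal there. *)

Section Matrices.
Context {K : realType}.

Definition signature_mx m (S : 'M[K]_m) : Prop :=
  is_diag_mx S /\ forall i, S i i = 1 \/ S i i = -1.

Definition quad_form m (M : 'M[K]_m) (v : 'cV[K]_m) : K :=
  (v^T *m M *m v) ord0 ord0.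

Definition pos_semidef_mx m (M : 'M[K]_m) : Prop :=
  M^T = M /\ forall v : 'cV[K]_m, 0 <= quad_form M v.

Definition pos_def_mx m (M : 'M[K]_m) : Prop :=
  M^T = M /\ forall v : 'cV[K]_m, v != 0 -> 0 < quad_form M v.

Definition mxnorm_inf m n (M : 'M[K]_(m, n)) : K :=
  \big[Num.max/0]_(i < m) \sum_(j < n) `|M i j|.

Definition expmx n (M : 'M[K]_n) : 'M[K]_n :=
  limn (fun N => \sum_(0 <= k < N) (k`!%:R)^-1 *: M ^+ k).

Definition mxintegral p q (E : set K) (F : K -> 'M[K]_(p, q)) : 'M[K]_(p, q) :=
  \matrix_(i, j) \int[lebesgue_measure]_(t in E) F t i j.

End Matrices.

Section System.
Context {K : realType} {n m : nat}.
Variables (A : 'M[K]_n) (B : 'M[K]_(n, m)) (C : 'M[K]_(m, n)) (D : 'M[K]_m).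

Definition transfer_function (s : K[i]) : 'M[K[i]]_m :=
  map_mx (real_complex K) C *m invmx (s%:M - map_mx (real_complex K) A)
    *m map_mx (real_complex K) B + map_mx (real_complex K) D.

(* The identity between rational matrices, stated pointwise off the poles of
   the resolvent (the finitely many eigenvalues of [A]), where [invmx] is a
   genuine inverse. *)
Definition externally_symmetric (Se : 'M[K]_m) : Prop :=
  forall s : K[i], s%:M - map_mx (real_complex K) A \in unitmx ->
    map_mx (real_complex K) Se *m (transfer_function s)^T =
    transfer_function s *m map_mx (real_complex K) Se.

(* Extended-real valued: the kernel C exp(At) B need not be integrable. *)
Definition peak_gain : \bar K :=
  (\big[maxe/0]_(i < m) \sum_(j < m)
     (`|D i j|%:E + \int[lebesgue_measure]_(t in `[0%R, +oo[)
                      `|(C *m expmx (t *: A) *m B) i j|%:E))%E.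

Variable tf : K.

(* Essential supremum over [0, tf]: the norm of a column vector is its largest
   absolute entry ([mx_norm]). *)
Definition Linf_norm (u : K -> 'cV[K]_m) : \bar K :=
  ess_sup (mrestr lebesgue_measure (measurable_itv `[0, tf]))
    (fun t => `|u t|%:E).

Definition Linf (u : K -> 'cV[K]_m) : Prop :=
  (forall i, measurable_fun `[0, tf] (fun t => u t i ord0)) /\
  (Linf_norm u < +oo)%E.

(* The input is only measurable, so dx/dt = A x + B u is understood in the
   sense of Caratheodory: x is continuous and satisfies the integrated
   equation. *)
Definition trajectory (x0 : 'cV[K]_n) (u : K -> 'cV[K]_m)
    (x : K -> 'cV[K]_n) (y : K -> 'cV[K]_m) : Prop :=
  [/\ {within `[0, tf], continuous x},
      forall t, t \in `[0, tf] ->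
        x t = x0 + mxintegral `[0, t] (fun r => A *m x r + B *m u r)
    & forall t, t \in `[0, tf] -> y t = C *m x t + D *m u t].

Variables (Q R : 'M[K]_m).

Definition cost (u y : K -> 'cV[K]_m) : K :=
  2^-1 * \int[lebesgue_measure]_(t in `[0, tf])
           (quad_form Q (y t) + quad_form R (u t)).

Definition optimal (x0 : 'cV[K]_n) (u : K -> 'cV[K]_m) : Prop :=
  Linf u /\
  exists x y, trajectory x0 u x y /\
    forall v xv yv, Linf v -> trajectory x0 v xv yv -> cost u y <= cost v yv.

Definition time_reversal (u : K -> 'cV[K]_m) : K -> 'cV[K]_m :=
  fun t => u (tf - t).

Definition io_operator (u : K -> 'cV[K]_m) : K -> 'cV[K]_m :=
  fun t => mxintegral `[0, t]
             (fun r => C *m expmx ((t - r) *: A) *m B *m u r) + D *m u t.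

Definition free_response (x0 : 'cV[K]_n) : K -> 'cV[K]_m :=
  fun t => C *m expmx (t *: A) *m x0.

Definition pointwise_mul (M : 'M[K]_m) (u : K -> 'cV[K]_m) : K -> 'cV[K]_m :=
  fun t => M *m u t.

Definition fixpoint_operator (Se : 'M[K]_m) (x0 : 'cV[K]_n)
    (u : K -> 'cV[K]_m) : K -> 'cV[K]_m :=
  pointwise_mul (- invmx R) (pointwise_mul Se (time_reversal (io_operator
    (pointwise_mul Se (pointwise_mul Q (time_reversal
      (io_operator u \+ free_response x0))))))).

Definition relaxed_iterate (Se : 'M[K]_m) (x0 : 'cV[K]_n) (alpha : K)
    (u0 : K -> 'cV[K]_m) (k : nat) : K -> 'cV[K]_m :=
  iter k (fun u t => (1 - alpha) *: u t + alpha *: fixpoint_operator Se x0 u t)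
    u0.

End System.

(* Main.v *)
Require Import Defs.
From HB Require Import structures.
From mathcomp Require Import all_boot all_order all_algebra.
From mathcomp Require Import all_classical all_reals all_analysis.
From mathcomp Require Import measurable_realfun ess_sup_inf complex ring lra.

Set Implicit Arguments.
Unset Strict Implicit.
Unset Printing Implicit Defensive.

Import Order.TTheory GRing.Theory Num.Theory.
Import numFieldNormedType.Exports.

Local Open Scope classical_set_scope.
Local Open Scope ring_scope.

(** Write [G] for the convolution operator [io_operator], [d] for
    [free_response], [h] for the impulse response, [T] for the horizon [tf], and
    [G^*] for the adjoint of [G] in L^2(0, T).

    External symmetry says that transposing the impulse response amounts to
    conjugating it by the signature matrix [Se]; since the adjoint of a causal
    convolution is the anticausal convolution with the transposed kernel,
    reversing time and conjugating by [Se] turns [G] into [G^*].  Hence the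
    operator of the iteration is [u |-> - R^-1 G^* Q (G u + d)]
    ([fixpoint_operator_adjoint]), and its fixed points are the solutions of the
    stationarity equation [R u + G^* Q (G u + d) = 0] of the convex quadratic
    cost.

    Both [G] and [G^*] have norm at most the peak gain for the supremum norm, so
    the operator is a contraction with factor
    [q = |Q| * gain^2 * |R^-1| < 1] ([fixpoint_operator_contraction]) and has a
    fixed point [w] ([contraction_fixed_point]).  Completing the square at [w]
    gives, for every input [v],
      [J v = J w + 1/2 * \int (e' Q e + (v - w)' R (v - w))], [e = G (v - w)]
    ([cost_expansion]); as [R] is positive definite, [w] is optimal and is a.e.
    equal to any optimal input.  The relaxed map contracts towards [w] with
    factor [1 - alpha + alpha * q < 1] ([relaxed_iterate_bound]).

    Two bridges connect this to the state-space data.  Transfer functions only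
    see the resolvent of [A]: its expansion at infinity gives the symmetry of the
    Markov parameters [C A^k B], hence that of the impulse response
    ([externally_symmetric_kernel]).  Trajectories are Caratheodory solutions:
    the variation of constants formula provides one by exchanging the order of
    integration ([trajectory_response]), and an exponentially weighted supremum
    shows that there is no other ([trajectory_unique]).

    Equality almost everywhere is handled without quotients: the fixed point
    argument is carried out for signals that are measurable and bounded at every
    point, and each essentially bounded signal is replaced by an a.e. equal one of
    this kind, a replacement compatible with all the operators ([ae_rep]). *)

(** * Bounded measurable functions on a segment *)
Section ScalarSignals.
Context {K : realType}.
Local Notation mu := (@lebesgue_measure K).
Implicit Types (f g k : K -> K) (a b c t T : K).

(** This class contains the continuous functions, is stable under products and
    under convolution with a continuous kernel, and is integrable on every
    subsegment; no finer integrability is ever at stake below. *)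
Definition bddmeas a b f : Prop :=
  measurable_fun `[a, b] f /\ exists c, forall t, t \in `[a, b] -> `|f t| <= c.

Lemma bddmeas_integrable a b f :
  bddmeas a b f -> mu.-integrable `[a, b] (EFin \o f).
Proof.
move=> [mf [c fc]]; apply: measurable_bounded_integrable => //.
  by rewrite [X in (X < _)%E]lebesgue_measure_itv/=; case: ifP => //; rewrite -EFinB ltry.
exists c; split; first exact: num_real.
by move=> x cx t /= /fc /le_trans; apply; exact: ltW.
Qed.

Lemma bddmeas_sub a b a' b' f : a <= a' -> b' <= b ->
  bddmeas a b f -> bddmeas a' b' f.
Proof.
move=> aa bb [mf [c fc]].
have sub : `[a', b'] `<=` `[a, b].
  by apply: subset_itv; rewrite bnd_simp.
split; first exact: measurable_funS mf.
by exists c => t /sub; exact: fc.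
Qed.

Lemma eq_bddmeas a b f g : {in `[a, b], f =1 g} ->
  bddmeas a b f -> bddmeas a b g.
Proof.
move=> fg [mf [c fc]]; split.
  by apply: eq_measurable_fun mf => x; rewrite inE/=; exact: fg.
by exists c => t tab; rewrite -fg// fc.
Qed.

Lemma bddmeas_cst a b c : bddmeas a b (cst c).
Proof. by split; [exact: measurable_cst|exists `|c|]. Qed.

Lemma bddmeasD a b f g : bddmeas a b f -> bddmeas a b g ->
  bddmeas a b (fun t => f t + g t).
Proof.
move=> [mf [c fc]] [mg [d gd]]; split; first exact: measurable_funD.
by exists (c + d) => t tab; rewrite (le_trans (ler_normD _ _))// lerD ?fc ?gd.
Qed.

Lemma bddmeasM a b f g : bddmeas a b f -> bddmeas a b g ->
  bddmeas a b (fun t => f t * g t).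
Proof.
move=> [mf [c fc]] [mg [d gd]]; split; first exact: measurable_funM.
by exists (c * d) => t tab; rewrite normrM ler_pM ?fc ?gd.
Qed.

Lemma bddmeasZ a b c f : bddmeas a b f -> bddmeas a b (fun t => c * f t).
Proof. exact/bddmeasM/bddmeas_cst. Qed.

Lemma bddmeas_norm a b f : bddmeas a b f -> bddmeas a b (fun t => `|f t|).
Proof.
move=> [mf [c fc]]; split; first exact: measurableT_comp.
by exists c => t tab; rewrite normr_id fc.
Qed.

Lemma bddmeas_sum (I : Type) (s : seq I) a b (F : I -> K -> K) :
  (forall i, bddmeas a b (F i)) -> bddmeas a b (fun t => \sum_(i <- s) F i t).
Proof.
move=> hF; elim: s => [|i s IH].
  by under eq_fun do rewrite big_nil; exact: bddmeas_cst.
by under eq_fun do rewrite big_cons; exact: bddmeasD.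
Qed.

Lemma bddmeas_within a b f : {within `[a, b], continuous f} -> bddmeas a b f.
Proof.
move=> cf; split; first exact: subspace_continuous_measurable_fun.
have [ab|ba] := leP a b; last first.
  by exists 0 => t; rewrite in_itv/= => /andP[/le_trans h /h]; rewrite leNgt ba.
have : {within `[a, b], continuous (fun t => `|f t|)}.
  by move=> x; apply: cvg_norm; exact: cf.
by move=> /(EVT_max ab)[c _ hc]; exists `|f c|.
Qed.

Lemma bddmeas_continuous a b f : continuous f -> bddmeas a b f.
Proof. by move=> cf; apply: bddmeas_within; exact: continuous_subspaceT. Qed.

Lemma measurable_reflection T : measurable_fun setT (fun t => T - t).
Proof. exact: measurable_funB. Qed.

Lemma reflection_itv T a b :
  (fun t => T - t) @^-1` `[T - b, T - a] = `[a, b]%classic.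
Proof.
apply/seteqP; split => t /=; rewrite !in_itv/= => /andP[h1 h2]; apply/andP; split; lra.
Qed.

(** It suffices to compare the two measures on half-open intervals, where the
    reflection exchanges the two sides, at no cost for the length. *)
Lemma lebesgue_measure_reflection T (A : set K) : measurable A ->
  pushforward mu ((fun t => T - t) : K -> measurableTypeR K) A = mu A.
Proof.
move=> mA; apply/esym/lebesgue_measure_unique => //=; first exact: measurable_reflection.
move=> _ _ [[a b]] _ <-.
rewrite /pushforward/= (_ : _ @^-1` _ = `[T - b, T - a[%classic); last first.
  by apply/seteqP; split => t /=; rewrite !in_itv/= => /andP[h1 h2];
    apply/andP; split; lra.
rewrite !lebesgue_measure_itv/= !lte_fin (_ : (T - b < T - a) = (a < b)).
  by case: ifP => // _; rewrite -!EFinB; congr EFin; ring.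
by apply/idP/idP; lra.
Qed.

Lemma ae_reflection T (P : K -> Prop) :
  {ae mu, forall t, P t} -> {ae mu, forall t, P (T - t)}.
Proof.
move=> [N [mN N0 PN]].
exists ((fun t => T - t) @^-1` N); split.
- by rewrite -[X in measurable X]setTI; exact: measurable_reflection.
- by have := lebesgue_measure_reflection T mN; rewrite /pushforward N0.
- by move=> t /= nP; apply: PN.
Qed.

Lemma bddmeas_reflection T a b f : bddmeas (T - b) (T - a) f ->
  bddmeas a b (fun t => f (T - t)).
Proof.
move=> [mf [c fc]]; split.
  apply: (@measurable_comp _ _ _ _ _ _ `[T - b, T - a]) => //.
    by rewrite -(reflection_itv T a b) => _ [t + <-].
  by apply: measurable_funTS; exact: measurable_reflection.
exists c => t tab; apply: fc; have := reflection_itv T a b.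
by move=> /(congr1 (fun A => A t)) /= ->.
Qed.

(** The change of variable must cover integrands that are merely measurable, so
    it comes from the invariance of the measure, applied to the function extended
    by 0 outside of the segment. *)
Lemma Rintegral_reflection T a b f : bddmeas (T - b) (T - a) f ->
  \int[mu]_(t in `[a, b]) f (T - t) = \int[mu]_(t in `[T - b, T - a]) f t.
Proof.
move=> bf; rewrite /Rintegral; congr fine.
set I : set (measurableTypeR K) := `[T - b, T - a]%classic.
set F := (EFin \o f) \_ I.
have mF : measurable_fun setT F.
  apply: (measurable_restrictT (EFin \o f) _).1; first exact: measurable_itv.
  by apply/measurable_EFinP; case: bf.
pose phi : K -> measurableTypeR K := fun t => T - t.
have mphi : measurable_fun setT phi by exact: measurable_reflection.
have FphiE : F \o phi = (EFin \o (fun t => f (T - t))) \_ `[a, b].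
  by apply/funext => t; rewrite /F /= !patchE -(reflection_itv T a b).
transitivity (\int[mu]_(t in setT) (F \o phi) t)%E.
  by rewrite FphiE [LHS]integral_mkcond.
transitivity (\int[pushforward mu phi]_(t in setT) F t)%E.
  rewrite integral_pushforward//= preimage_setT FphiE.
  apply/(iffLR (integrable_mkcond (mu:=mu) (D := `[a, b]) _ _)).
    exact: measurable_itv.
  exact/bddmeas_integrable/bddmeas_reflection.
rewrite [RHS]integral_mkcond -/F.
by apply: eq_measure_integral => A mA _; exact: lebesgue_measure_reflection.
Qed.
End ScalarSignals.

(** * Causal convolution *)
Section Convolution.
Context {K : realType}.
Local Notation mu := (@lebesgue_measure K).
Local Notation RK := (measurableTypeR K).
Implicit Types (f k : K -> K) (a b c t T : K).

(** Fubini for a bounded function supported in a square: every section is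
    integrable, so the inner integrals are finite at every point and the exchange
    can be stated with real-valued integrals. *)
Lemma Rintegral_swap T (g : K -> K -> K) (c : K) :
  measurable_fun setT (fun z : RK * RK => g z.1 z.2 : RK) ->
  (forall s r, `|g s r| <= c) ->
  (forall s r, ~ (s \in `[0, T] /\ r \in `[0, T]) -> g s r = 0) ->
  measurable_fun setT (fun s : RK => \int[mu]_r g s r : RK) /\
  \int[mu]_s \int[mu]_r g s r = \int[mu]_r \int[mu]_s g s r.
Proof.
move=> mg gc g0.
pose I : set RK := `[0, T]%classic.
have mI : measurable I by exact: measurable_itv.
have muI : (mu I < +oo)%E.
  by rewrite [X in (X < _)%E]lebesgue_measure_itv/=; case: ifP => //; rewrite -EFinB ltry.
pose f (z : RK * RK) := (g z.1 z.2)%:E.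
have sec1 s : mu.-integrable setT (fun r => (g s r)%:E).
  have -> : (fun r => (g s r)%:E) = (EFin \o g s) \_ I.
    apply/funext => r; rewrite patchE /=; case: ifPn => // /negP rI.
    by rewrite g0// => -[_ /mem_set].
  apply/(iffLR (integrable_mkcond (mu:=mu) (D := I) _ mI)).
  apply: measurable_bounded_integrable => //.
    apply: measurable_funTS.
    exact: (measurableT_comp mg (measurable_pair1 s)).
  exists c; split; first exact: num_real.
  by move=> x cx r _; rewrite /= (le_trans (gc _ _))// ltW.
have sec2 r : mu.-integrable setT (fun s => (g s r)%:E).
  have -> : (fun s => (g s r)%:E) = (EFin \o g ^~ r) \_ I.
    apply/funext => s; rewrite patchE /=; case: ifPn => // /negP rI.
    by rewrite g0// => -[/mem_set].
  apply/(iffLR (integrable_mkcond (mu:=mu) (D := I) _ mI)).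
  apply: measurable_bounded_integrable => //.
    apply: measurable_funTS.
    exact: (measurableT_comp mg (measurable_pair2 r)).
  exists c; split; first exact: num_real.
  by move=> x cx s _; rewrite /= (le_trans (gc _ _))// ltW.
have fint : (mu \x mu)%E.-integrable setT f.
  have mII : measurable (I `*` I) by exact: measurableX.
  have -> : f = (EFin \o (fun z : RK * RK => g z.1 z.2)) \_ (I `*` I).
    apply/funext => z; rewrite patchE /f /=; case: ifPn => // /negP rI.
    by rewrite g0// => -[h1 h2]; apply: rI; apply/mem_set; split.
  apply/(iffLR (integrable_mkcond (D := I `*` I) _ mII)).
  apply: measurable_bounded_integrable => //.
  - rewrite [X in (X < _)%E](product_measure1E mu mu mI mI).
    by apply: lte_mul_pinfty => //; rewrite ge0_fin_numE.
  - exact: measurable_funTS.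
  exists c; split; first exact: num_real.
  by move=> x cx z _; rewrite /= (le_trans (gc _ _))// ltW.
have E1 s : (\int[mu]_r g s r)%:E = fubini_F mu f s.
  by rewrite /Rintegral fineK//; apply: integrable_fin_num.
have E2 r : (\int[mu]_s g s r)%:E = fubini_G mu f r.
  by rewrite /Rintegral fineK//; apply: integrable_fin_num.
split.
  apply/measurable_EFinP.
  rewrite (_ : EFin \o _ = fubini_F mu f); first exact: (measurable_fubini_F fint).
  by apply/funext => s; rewrite /= E1.
rewrite [LHS]/Rintegral [RHS]/Rintegral; congr fine.
under eq_integral do rewrite E1.
under [RHS]eq_integral do rewrite E2.
exact: Fubini.
Qed.

Lemma le_normr_Rintegral_itv a b c f : a <= b -> bddmeas a b f ->
  (forall t, t \in `[a, b] -> `|f t| <= c) ->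
  `|\int[mu]_(t in `[a, b]) f t| <= c * (b - a).
Proof.
move=> ab bf fc; have fi := bddmeas_integrable bf.
apply: (le_trans (le_normr_Rintegral _ fi)); first exact: measurable_itv.
have -> : c * (b - a) = \int[mu]_(t in `[a, b]) c.
  rewrite Rintegral_cst; last exact: measurable_itv.
  rewrite [X in fine X]lebesgue_measure_itv/= lte_fin; case: ltP => [//|ba].
  by rewrite (le_anti (introT andP (conj ab ba))) subrr.
apply: le_Rintegral => //.
- exact/bddmeas_integrable/bddmeas_norm.
- exact/bddmeas_integrable/bddmeas_cst.
Qed.

Definition convolve k f t := \int[mu]_(r in `[0, t]) (k (t - r) * f r).

Lemma bddmeas_convolve_integrand k f t T : t <= T ->
  continuous k -> bddmeas 0 T f -> bddmeas 0 t (fun r => k (t - r) * f r).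
Proof.
move=> tT ck bf; apply: bddmeasM; last exact: bddmeas_sub bf.
apply: bddmeas_continuous => r; apply: continuous_comp; last exact: ck.
by apply: cvgB; [exact: cvg_cst|exact: cvg_id].
Qed.

(** The domain is the triangle [0 <= r <= s <= T].  Restricting the kernel [k]
    itself to [[0, T]] encodes the causality condition [r <= s], so that the
    integrand becomes a plain product of functions on the square. *)
Lemma convolve_swap T (a : K -> K) k f : 0 <= T ->
  bddmeas 0 T a -> continuous k -> bddmeas 0 T f ->
  measurable_fun `[0, T] (fun s => a s * convolve k f s) /\
  \int[mu]_(s in `[0, T]) (a s * convolve k f s) =
  \int[mu]_(r in `[0, T]) ((\int[mu]_(s in `[r, T]) (a s * k (s - r))) * f r).
Proof.
move=> T0 ba ck bf; set I : set RK := `[0, T]%classic.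
have mI : measurable I by exact: measurable_itv.
have inI t : (t \in I) = (t \in `[0, T]) by rewrite mem_setE.
(* For [s] and [r] in [[0, T]], [s - r] lies in [[0, T]] exactly when [r <= s]. *)
pose g s r := (a \_ I) s * ((k \_ I) (s - r) * (f \_ I) r).
have [ma [ca hca]] := ba.
have [mk [k0 hk0]] := @bddmeas_continuous _ 0 T k ck.
have [mf [cf hcf]] := bf.
have bnd (h : K -> K) c : (forall t, t \in `[0, T] -> `|h t| <= c) ->
    forall t, `|(h \_ I) t| <= `|c|.
  move=> hc t; rewrite patchE; case: ifPn => [tI|_]; last by rewrite normr0.
  by rewrite (le_trans _ (ler_norm _))// hc// -inI.
have mg : measurable_fun setT (fun z : RK * RK => g z.1 z.2 : RK).
  have mp h : measurable_fun `[0, T] h -> measurable_fun setT (h \_ I : RK -> RK).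
    exact: (measurable_restrictT _ mI).1.
  apply: measurable_funM; first exact: (measurableT_comp (mp _ ma) measurable_fst).
  apply: measurable_funM; last exact: (measurableT_comp (mp _ mf) measurable_snd).
  apply: (measurableT_comp (mp _ mk)).
  by apply: measurable_funB; [exact: measurable_fst|exact: measurable_snd].
have gc s r : `|g s r| <= `|ca| * (`|k0| * `|cf|).
  by rewrite !normrM !ler_pM ?mulr_ge0// bnd.
have g0 s r : ~ (s \in `[0, T] /\ r \in `[0, T]) -> g s r = 0.
  rewrite /g !patchE !inI; case: ifPn => sI; last by rewrite mul0r.
  by case: (ifPn (r \in _)) => rI; [move=> []|rewrite !mulr0].
have [mF swap] := Rintegral_swap mg gc g0.
have E1 s : \int[mu]_r g s r = ((fun s => a s * convolve k f s) \_ I) s.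
  rewrite patchE /g patchE inI; case: ifPn => sI; last first.
    rewrite (@eq_Rintegral _ _ _ mu _ (cst 0)); last by move=> r _; rewrite mul0r.
    by rewrite Rintegral_cst// mul0r.
  have [s0 sT] : 0 <= s /\ s <= T by move: sI; rewrite in_itv/= => /andP[].
  have bi := bddmeas_convolve_integrand sT ck bf.
  rewrite /convolve -RintegralZl//; last exact: bddmeas_integrable bi.
  rewrite [RHS]Rintegral_mkcond; apply: eq_Rintegral => r _.
  rewrite !patchE !inI.
  rewrite mem_setE !in_itv/=.
  have [r0|r0] := leP 0 r; have [rs|rs] := leP r s; rewrite ?andbF ?mulr0 ?mul0r//=.
  - have rT := le_trans rs sT.
    have srT : s - r <= T by rewrite lerBlDr (le_trans sT)// lerDl.
    by rewrite rT subr_ge0 rs srT.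
  - by rewrite subr_ge0 leNgt rs/= mul0r mulr0.
have E2 r : \int[mu]_s g s r =
    ((fun r => (\int[mu]_(s in `[r, T]) (a s * k (s - r))) * f r) \_ I) r.
  rewrite patchE /g patchE inI; case: ifPn => rI; last first.
    rewrite (@eq_Rintegral _ _ _ mu _ (cst 0)); last by move=> s _; rewrite !mulr0.
    by rewrite Rintegral_cst// mul0r.
  have [r0 rT] : 0 <= r /\ r <= T by move: rI; rewrite in_itv/= => /andP[].
  have bi : bddmeas r T (fun s => a s * k (s - r)).
    apply: bddmeasM; first exact: bddmeas_sub ba.
    apply: bddmeas_continuous => s; apply: continuous_comp; last exact: ck.
    by apply: cvgB; [exact: cvg_id|exact: cvg_cst].
  rewrite -RintegralZr//; last exact: bddmeas_integrable bi.
  rewrite [RHS]Rintegral_mkcond; apply: eq_Rintegral => s _.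
  rewrite !patchE !inI mulrA.
  rewrite mem_setE !in_itv/=.
  have [rs|rs] := leP r s; have [sT|sT] := leP s T; rewrite ?andbF ?mulr0 ?mul0r//=.
  - have srT : s - r <= T by rewrite lerBlDr (le_trans sT)// lerDl.
    by rewrite (le_trans r0 rs) subr_ge0 rs srT.
  - by rewrite subr_ge0 [r <= s]leNgt rs/= mulr0 mul0r.
split.
  apply/(measurable_restrictT _ mI).
  by apply: eq_measurable_fun mF => s _; rewrite E1.
rewrite [LHS]Rintegral_mkcond [RHS]Rintegral_mkcond.
rewrite -(eq_Rintegral mu (fun s _ => E1 s)) swap.
by apply: eq_Rintegral => r _; rewrite E2.
Qed.

Lemma bddmeas_convolve T k f : continuous k -> bddmeas 0 T f ->
  bddmeas 0 T (convolve k f).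
Proof.
move=> ck bf; have [T0|T0] := leP 0 T; last first.
  apply: (@eq_bddmeas _ _ _ (cst 0)); last exact: bddmeas_cst.
  by move=> t; rewrite in_itv/=; lra.
have [m1 _] := convolve_swap T0 (bddmeas_cst 0 T 1) ck bf.
split; first by apply: eq_measurable_fun m1 => s _; rewrite /= mul1r.
have [_ [k0 hk0]] := @bddmeas_continuous _ 0 T k ck.
have [mf [cf hcf]] := bf.
exists (`|k0| * `|cf| * T) => t; rewrite in_itv/= => /andP[t0 tT].
apply: (le_trans (le_normr_Rintegral_itv (c := `|k0| * `|cf|) t0 _ _)).
- exact: bddmeas_convolve_integrand bf.
- move=> r; rewrite in_itv/= => /andP[r0 rt]; rewrite normrM ler_pM//.
    by rewrite (le_trans _ (ler_norm _))// hk0// in_itv/=; lra.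
  by rewrite (le_trans _ (ler_norm _))// hcf// in_itv/=; lra.
- by rewrite subr0 ler_wpM2l// mulr_ge0.
Qed.

Lemma Rintegral_sum (J : Type) (s : seq J) a b (F : J -> K -> K) :
  (forall j, bddmeas a b (F j)) ->
  \int[mu]_(t in `[a, b]) (\sum_(j <- s) F j t) =
  \sum_(j <- s) \int[mu]_(t in `[a, b]) F j t.
Proof.
move=> bF; elim: s => [|j s IH].
  rewrite big_nil (@eq_Rintegral _ _ _ mu _ (cst 0)); last by move=> t _; rewrite big_nil.
  by rewrite Rintegral_cst ?mul0r//; exact: measurable_itv.
rewrite big_cons -IH (@eq_Rintegral _ _ _ mu _ (fun t => F j t + \sum_(j <- s) F j t)).
  by rewrite RintegralD//; apply: bddmeas_integrable => //; exact: bddmeas_sum.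
by move=> t _; rewrite big_cons.
Qed.

Lemma ae_eq_Rintegral a b f g :
  measurable_fun `[a, b] f -> measurable_fun `[a, b] g ->
  {ae mu, forall t, t \in `[a, b] -> f t = g t} ->
  \int[mu]_(t in `[a, b]) f t = \int[mu]_(t in `[a, b]) g t.
Proof.
move=> mf mg fg; rewrite /Rintegral; congr fine; apply: ae_eq_integral => //.
- exact/measurable_EFinP.
- exact/measurable_EFinP.
- apply: filterS fg; first exact: (ae_filter_ringOfSetsType mu).
  by move=> t /= h /h ->.
Qed.

(** After the exchange of integrals, the inner integral over [[r, T]] becomes a
    causal convolution once time is reversed. *)
Lemma convolve_adjoint T (a : K -> K) k f : 0 <= T ->
  bddmeas 0 T a -> continuous k -> bddmeas 0 T f ->
  \int[mu]_(s in `[0, T]) (a s * convolve k f s) =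
  \int[mu]_(r in `[0, T]) (convolve k (fun s => a (T - s)) (T - r) * f r).
Proof.
move=> T0 ba ck bf; have [_ ->] := convolve_swap T0 ba ck bf.
apply: eq_Rintegral => r; rewrite inE/= in_itv/= => /andP[r0 rT].
congr (_ * _).
pose g s := a s * k (s - r).
have bg : bddmeas (T - (T - r)) (T - 0) g.
  rewrite subKr subr0; apply: bddmeasM; first exact: bddmeas_sub ba.
  apply: bddmeas_continuous => s; apply: continuous_comp; last exact: ck.
  by apply: cvgB; [exact: cvg_id|exact: cvg_cst].
have := Rintegral_reflection bg; rewrite subKr subr0 => <-.
by apply: eq_Rintegral => s _; rewrite /g mulrC addrAC.
Qed.

(** The scalar form of the peak-to-peak estimate: the L^1 norm of the kernel
    bounds the convolution for the supremum norm. *)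
Lemma convolve_bound T k f c t : continuous k -> bddmeas 0 T f ->
  (forall s, s \in `[0, T] -> `|f s| <= c) -> t \in `[0, T] ->
  `|convolve k f t| <= c * \int[mu]_(s in `[0, T]) `|k s|.
Proof.
move=> ck bf fc tT; have [t0 tT'] := andP tT; rewrite /= in t0 tT'.
have c0 : 0 <= c by exact: le_trans (normr_ge0 _) (fc t tT).
have bi := bddmeas_convolve_integrand tT' ck bf.
have nk : continuous (fun s => `|k s|) by move=> s; apply: cvg_norm; exact: ck.
have bk a b : bddmeas a b (fun s => `|k s|) by exact: bddmeas_continuous.
have bkr : bddmeas 0 t (fun s => `|k (t - s)|) by exact: (@bddmeas_reflection _ t 0 t _ (bk _ _)).
have -> : \int[mu]_(s in `[0, T]) `|k s| =
    \int[mu]_(s in `[0, t]) `|k s| + \int[mu]_(s in `]t, T]) `|k s|.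
  rewrite -(@Rintegral_itvB _ _ (BLeft 0) (BRight T) t)//; first by rewrite addrC subrK.
  exact: bddmeas_integrable.
apply: (@le_trans _ _ (c * \int[mu]_(s in `[0, t]) `|k s|)); last first.
  by rewrite ler_wpM2l// lerDl Rintegral_ge0.
have -> : \int[mu]_(s in `[0, t]) `|k s| = \int[mu]_(s in `[0, t]) `|k (t - s)|.
  have := @Rintegral_reflection _ t 0 t (fun s => `|k s|) (bk _ _).
  by rewrite subrr subr0.
rewrite -RintegralZl//; last exact: bddmeas_integrable.
apply: (le_trans (le_normr_Rintegral _ (bddmeas_integrable bi))) => //.
apply: le_Rintegral => //.
- exact/bddmeas_integrable/bddmeas_norm.
- exact/bddmeas_integrable/bddmeasZ.
- move=> s; rewrite /= in_itv/= => /andP[s0 st].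
  by rewrite normrM mulrC ler_wpM2r// fc// in_itv/= s0 (le_trans st).
Qed.
End Convolution.

(** * The matrix exponential *)
Lemma cvg_mx_entries (K : realType) (p q : nat) (I : Type) (F : set_system I)
    (FF : Filter F) (f : I -> 'M[K]_(p, q)) (M : 'M[K]_(p, q)) :
  (forall i j, f x i j @[x --> F] --> M i j) -> f x @[x --> F] --> M.
Proof.
move=> fM; apply/cvgrPdist_le => e e0.
have H : \forall x \near F, forall ij : 'I_p * 'I_q, `|M ij.1 ij.2 - f x ij.1 ij.2| <= e.
  by apply: filter_forall => ij; have /cvgrPdist_le := fM ij.1 ij.2; exact.
near=> x; have Hx : forall ij : 'I_p * 'I_q, `|M ij.1 ij.2 - f x ij.1 ij.2| <= e by near: x.
rewrite [leLHS]mx_normrE; apply/bigmax_leP; split; first exact: ltW.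
by move=> ij _; rewrite !mxE; exact: Hx.
Unshelve. all: by end_near. Qed.

Section MatrixExponential.
Context {K : realType} {n : nat}.
Variable A : 'M[K]_n.
Implicit Types (P : 'M[K]_n) (t : K).

(** The entries of [P *m expmx (t *: A)] are power series in [t].  The left factor
    [P] is there because differentiating termwise replaces [P] by [P *m A]: the
    family is closed under differentiation. *)
Let coef P (i j : 'I_n) : K^nat := fun k => (k`!%:R)^-1 * (P *m A ^+ k) i j.

(** A norm for which [`|(P A^k) i j| <= mxsum P * mxsum A ^ k]: with the largest
    entry instead, powers of the dimension would appear. *)
Let mxsum P : K := \sum_i \sum_j `|P i j|.

Let mxsum_row P i : \sum_j `|P i j| <= mxsum P.
Proof.
rewrite /mxsum [leRHS](bigD1 i)//= lerDl sumr_ge0// => l _.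
by rewrite sumr_ge0.
Qed.

Let expr_entry_le P k i j : `|(P *m A ^+ k) i j| <= mxsum P * mxsum A ^+ k.
Proof.
elim: k P i => [|k IH] P i.
  rewrite expr0 mulmx1 mulr1 (le_trans _ (mxsum_row P i))//.
  by rewrite [leRHS](bigD1 j)//= lerDl sumr_ge0.
rewrite !exprS mxE.
apply: (le_trans (ler_norm_sum _ _ _)).
apply: (@le_trans _ _ (\sum_l `|P i l| * (mxsum A * mxsum A ^+ k))).
  by apply: ler_sum => l _; rewrite normrM ler_wpM2l// IH.
rewrite -mulr_suml ler_wpM2r ?mxsum_row// mulr_ge0 ?exprn_ge0//;
  by rewrite sumr_ge0// => *; rewrite sumr_ge0.
Qed.

Let cvg_coef P i j t : cvgn (pseries (coef P i j) t).
Proof.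
apply: normed_cvg; apply: (@series_le_cvg _ _ (fun k => mxsum P * exp_coeff (mxsum A * `|t|) k)).
- by move=> k; exact: normr_ge0.
- move=> k; rewrite mulr_ge0 ?exp_coeff_ge0 ?mulr_ge0//;
    by rewrite sumr_ge0// => *; rewrite sumr_ge0.
- move=> k; rewrite /= !normrM /exp_coeff/= normrX exprMn [X in X * _ * _]ger0_norm ?invr_ge0//.
  rewrite [leRHS](_ : _ = (k`!%:R)^-1 * (mxsum P * mxsum A ^+ k) * `|t| ^+ k); last by rewrite /=; ring.
  by rewrite ler_wpM2r ?exprn_ge0// ler_wpM2l ?invr_ge0.
- exact/is_cvg_seriesZ/is_cvg_series_exp_coeff.
Qed.

Let coef_diffs P i j : pseries_diffs (coef P i j) = coef (P *m A) i j.
Proof.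
apply/funext => k; rewrite /pseries_diffs /coef factS natrM invfM mulrA mulrA mulfV// mul1r.
by rewrite exprS -mulmxE mulmxA.
Qed.

Lemma exprmxZ t k : (t *: A) ^+ k = t ^+ k *: A ^+ k.
Proof.
elim: k => [|k IH]; first by rewrite !expr0 scale1r.
by rewrite !exprS IH -!mulmxE -scalemxAl -scalemxAr scalerA.
Qed.

Let coef_partial P t N :
  P *m (\sum_(0 <= k < N) (k`!%:R)^-1 *: (t *: A) ^+ k) =
  \matrix_(i, j) pseries (coef P i j) t N.
Proof.
apply/matrixP => i j; rewrite mulmx_sumr summxE mxE /pseries /series/=.
apply: eq_bigr => k _; rewrite -scalemxAr mxE /coef.
rewrite exprmxZ -scalemxAr mxE; ring.
Qed.

Let expmx_cvg t : (fun N => \sum_(0 <= k < N) (k`!%:R)^-1 *: (t *: A) ^+ k) @ \oo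
   --> \matrix_(i, j) limn (pseries (coef 1%:M i j) t).
Proof.
apply: cvg_mx_entries => i j; rewrite mxE.
have := @cvg_coef 1%:M i j t; apply: cvg_trans; apply: near_eq_cvg.
by apply: nearW => N; rewrite -[X in _ = fun_of_matrix X _ _]mul1mx coef_partial mxE.
Qed.

Lemma expmx_partial_cvg t :
  (fun N => \sum_(0 <= k < N) (k`!%:R)^-1 *: (t *: A) ^+ k) @ \oo --> expmx (t *: A).
Proof. by have := @expmx_cvg t => /[dup] /cvg_lim <-. Qed.

Let mul_expmxE P t i j : (P *m expmx (t *: A)) i j = limn (pseries (coef P i j) t).
Proof.
apply/esym/cvg_lim => //.
have -> : pseries (coef P i j) t = fun N =>
    \sum_l P i l * (\sum_(0 <= k < N) (k`!%:R)^-1 *: (t *: A) ^+ k) l j.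
  by apply/funext => N; have := coef_partial P t N => /matrixP/(_ i j); rewrite !mxE.
rewrite mxE; apply: cvg_big => [|l _]; first exact: add_continuous.
apply: cvgM; first exact: cvg_cst.
exact: cvg_comp (@expmx_partial_cvg t) (@coord_continuous _ _ _ l j _).
Qed.

(** Termwise differentiation inside the disc of convergence; any point beyond
    [t], such as [`|t| + 1], serves to witness convergence. *)
Lemma is_derive_expmx t i j :
  is_derive t 1 (fun t => expmx (t *: A) i j) ((A *m expmx (t *: A)) i j).
Proof.
have -> : (fun t => expmx (t *: A) i j) = fun t => limn (pseries (coef 1%:M i j) t).
  by apply/funext => s; rewrite -mul_expmxE mul1mx.
have E : coef A i j = pseries_diffs (coef 1%:M i j) by rewrite coef_diffs mul1mx.
rewrite mul_expmxE E.
apply: (@pseries_snd_diffs _ _ (`|t| + 1)); rewrite ?coef_diffs ?mul1mx//.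
by rewrite [ltRHS]ger0_norm ?ltrDl.
Qed.

Lemma expmx0 : expmx (0 *: A) = 1%:M.
Proof.
apply: cvg_lim => //; apply: cvg_near_cst; exists 1%N => // N /= N1.
rewrite scale0r big_ltn// expr0 fact0 invr1 scale1r big1_seq ?addr0// => k.
by rewrite mem_index_iota => /andP[_ /andP[k1 _]]; rewrite expr0n gtn_eqF// scaler0.
Qed.

Lemma continuous_expmx i j : continuous (fun t => expmx (t *: A) i j).
Proof.
move=> t; apply: differentiable_continuous; apply/derivable1_diffP.
by have [] := is_derive_expmx t i j.
Qed.
End MatrixExponential.

(** * Estimates for the entrywise norm of matrices *)
Section MatrixNorm.
Context {K : realType}.

Lemma mx_norm_leP (p q : nat) (M : 'M[K]_(p, q)) (c : K) : 0 <= c ->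
  reflect (forall i j, `|M i j| <= c) (`|M| <= c).
Proof.
move=> c0; apply: (iffP idP) => [h i j|h]; rewrite ?[leLHS]mx_normrE.
  by apply: le_trans h; rewrite [leRHS]mx_normrE (le_bigmax _ _ (i, j)).
by apply/bigmax_leP; split => // ij _; exact: h.
Qed.

Lemma mx_norm_entry (p q : nat) (M : 'M[K]_(p, q)) i j : `|M i j| <= `|M|.
Proof. by move: i j; apply/mx_norm_leP. Qed.

Lemma mx_norm_mulmx (p q r : nat) (M : 'M[K]_(p, q)) (N : 'M[K]_(q, r)) :
  `|M *m N| <= q%:R * `|M| * `|N|.
Proof.
apply/mx_norm_leP => [|i j]; first by rewrite !mulr_ge0.
rewrite mxE (le_trans (ler_norm_sum _ _ _))//.
apply: (@le_trans _ _ (\sum_(l < q) `|M| * `|N|)).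
  by apply: ler_sum => l _; rewrite normrM ler_pM// mx_norm_entry.
by rewrite sumr_const card_ord -[leLHS]mulr_natl mulrA.
Qed.

Lemma mx_norm_trmx (p q : nat) (M : 'M[K]_(p, q)) : `|M^T| = `|M|.
Proof.
apply/eqP; rewrite eq_le; apply/andP; split; apply/mx_norm_leP => // i j.
  by rewrite mxE mx_norm_entry.
by have := mx_norm_entry M^T j i; rewrite mxE.
Qed.

Lemma eq0_of_le_small (z c d : K) : 0 < d ->
  0 <= z -> (forall w, 0 < w <= d -> z <= c * w) -> z = 0.
Proof.
move=> d0 z0 h; apply/eqP; rewrite eq_le z0 andbT leNgt; apply/negP => zp.
have cp : 0 < c by have := h d; rewrite d0 lexx => /(_ isT) /(lt_le_trans zp); rewrite pmulr_lgt0.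
have := h (Num.min d (z / c / 2)); rewrite lt_min d0 !divr_gt0// ge_min lexx => /(_ isT).
have : c * Num.min d (z / c / 2) <= c * (z / c / 2) by rewrite ler_pM2l// ge_min lexx orbT.
rewrite [X in _ <= X -> _](_ : _ = z / 2); last by field; rewrite gt_eqF.
lra.
Qed.

End MatrixNorm.

(** * From the transfer function to the impulse response *)
Section ExternalSymmetry.
Context {K : realType} {n m : nat}.
Variables (A : 'M[K]_n) (B : 'M[K]_(n, m)) (C : 'M[K]_(m, n)) (D S : 'M[K]_m).

(** Linear in [X] and zero exactly when [X] has the symmetry at stake. *)
Let defect (X : 'M[K]_m) : 'M[K]_m := S *m X^T - X *m S.

Let defectD X Y : defect (X + Y) = defect X + defect Y.
Proof. by rewrite /defect linearD/= mulmxDr mulmxDl opprD addrACA. Qed.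

Let defectZ a X : defect (a *: X) = a *: defect X.
Proof. by rewrite /defect linearZ/= -scalemxAr -scalemxAl scalerBr. Qed.

Let defect_bound (L : 'M[K]_(m, n)) :
  exists2 c, 0 <= c & forall X : 'M[K]_n, `|defect (L *m X *m B)| <= c * `|X|.
Proof.
exists ((m%:R * `|S| + m%:R * `|S|) * (n%:R * (n%:R * `|L|) * `|B|)).
  by rewrite !mulr_ge0// addr_ge0// mulr_ge0.
move=> X; have HX : `|L *m X *m B| <= n%:R * (n%:R * `|L|) * `|B| * `|X|.
  apply: (le_trans (mx_norm_mulmx _ _)).
  rewrite -!mulrA ler_wpM2l// [leRHS](_ : _ = n%:R * `|L| * `|X| * `|B|); last by ring.
  by rewrite ler_wpM2r// mx_norm_mulmx.
apply: (@le_trans _ _ ((m%:R * `|S| + m%:R * `|S|) * `|L *m X *m B|)).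
  rewrite /defect (le_trans (ler_normB _ _))// mulrDl lerD//.
    by rewrite -(mx_norm_trmx (L *m X *m B)) mx_norm_mulmx.
  by rewrite (le_trans (mx_norm_mulmx _ _))// mulrAC.
by rewrite -[leRHS]mulrA ler_wpM2l// addr_ge0// mulr_ge0.
Qed.

Hypothesis hsym : externally_symmetric A B C D S.

(** Only real values of [s] are used, for which everything lives over [K]. *)
Let defect_resolvent (s : K) : s%:M - A \in unitmx ->
  defect (C *m invmx (s%:M - A) *m B + D) = 0.
Proof.
move=> sA; pose f := real_complex K.
have E : (f s)%:M - map_mx f A = map_mx f (s%:M - A).
  by rewrite map_mxB map_scalar_mx.
have := hsym (s := f s); rewrite /transfer_function E map_unitmx sA => /(_ isT).
rewrite -map_invmx -!map_mxM -map_mxD matrix.map_trmx -!map_mxM => /map_mx_inj h.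
by rewrite /defect h subrr.
Qed.

(** With [w = 1 / s], the resolvent is [w *: invmx (1 - w *: A)].  Below this radius
    [w *: A] shrinks norms by one half, which makes [1 - w *: A] invertible with an
    inverse bounded independently of [w]. *)
Let d : K := (2 * (n%:R * `|A| + 1))^-1.

Let d0 : 0 < d.
Proof. by rewrite invr_gt0 mulr_gt0// ltr_wpDl// mulr_ge0. Qed.

Let small w (p : nat) (X : 'M[K]_(n, p)) : 0 < w <= d -> `|w *: (A *m X)| <= `|X| / 2.
Proof.
move=> /andP[w0 wd]; rewrite normrZ gtr0_norm//.
apply: (@le_trans _ _ (d * (n%:R * `|A| * `|X|))).
  by rewrite ler_pM ?mx_norm_mulmx// ltW.
rewrite mulrA [leRHS]mulrC ler_wpM2r//.
have := mulr_ge0 (ler0n K n) (normr_ge0 A); rewrite /d; set a := _ * `|A| => a0.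
by rewrite -ler_pdivlMl ?invr_gt0; [rewrite invrK; lra|lra].
Qed.

Let unit_small w : 0 < w <= d -> 1%:M - w *: A \in unitmx.
Proof.
move=> wd; rewrite -unitmx_tr -row_free_unit -kermx_eq0 -trmx_eq0.
set Y := (kermx _)^T.
have /(congr1 trmx) : kermx (1%:M - w *: A)^T *m (1%:M - w *: A)^T = 0 by exact: mulmx_ker.
rewrite trmx_mul trmxK trmx0 mulmxBl mul1mx -scalemxAl => /eqP.
rewrite subr_eq0 => /eqP YE.
have := small Y wd; rewrite -YE -normr_eq0; have := normr_ge0 Y; lra.
Qed.

Let X w := invmx (1%:M - w *: A).

Let XE w : 0 < w <= d -> X w = 1%:M + w *: (A *m X w).
Proof.
move=> /unit_small u; have := mulmxV u; rewrite mulmxBl mul1mx -scalemxAl -/(X w).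
by move=> <-; rewrite subrK.
Qed.

Let X_bound w : 0 < w <= d -> `|X w| <= 2.
Proof.
move=> wd; have h := XE wd; have := ler_normD 1%:M (w *: (A *m X w)); rewrite -h.
have := small (X w) wd; have : `|1%:M : 'M[K]_n| <= 1.
  by apply/mx_norm_leP => // i j; rewrite mxE; case: eqP => //; rewrite ?normr1 ?normr0.
by lra.
Qed.

Let resolvent w : 0 < w <= d -> w *: defect (C *m X w *m B) + defect D = 0.
Proof.
move=> wd; have [w0 _] := andP wd.
have E : w^-1%:M - A = w^-1 *: (1%:M - w *: A).
  by rewrite scalerBr scalemx1 scalerA mulVf ?gt_eqF// scale1r.
have u : w^-1%:M - A \in unitmx.
  by rewrite E unitmxZ ?unit_small// unitfE invr_eq0 gt_eqF.
have := defect_resolvent u; rewrite E invmxZ; last by rewrite -E.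
by rewrite invrK -scalemxAr -scalemxAl defectD defectZ.
Qed.

(** How a coefficient of the expansion at [w = 0] is isolated: [Z] does not depend
    on [w], whereas the other term is [O(w)] because [X w] stays bounded. *)
Let defect_small (Z : 'M[K]_m) (L : 'M[K]_(m, n)) :
  (forall w, 0 < w <= d -> w *: defect (L *m X w *m B) + Z = 0) -> Z = 0.
Proof.
move=> h; have [c c0 hc] := defect_bound L; apply/eqP; rewrite -normr_eq0; apply/eqP.
apply: (@eq0_of_le_small _ _ (c * 2) d) => // w wd.
have /eqP := h _ wd; rewrite addrC addr_eq0 => /eqP ->; rewrite normrN normrZ.
have [w0 _] := andP wd; rewrite gtr0_norm// mulrC ler_wpM2r// ?(ltW w0)//.
by rewrite (le_trans (hc _))// ler_wpM2l// X_bound.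
Qed.

Lemma externally_symmetric_feedthrough : S *m D^T = D *m S.
Proof. by apply/eqP; rewrite -subr_eq0; apply/eqP/(defect_small resolvent). Qed.

(** Induction on the order of the expansion: by [XE], the defect of [C A^k X B] is
    that of [C A^k B] plus [w] times that of [C A^(k+1) X B].  The first of the two
    is 0 by [defect_small], and then so is the second. *)
Let defect_markov_resolvent k w : 0 < w <= d -> defect (C *m A ^+ k *m X w *m B) = 0.
Proof.
elim: k w => [|k IH] w wd.
  have := resolvent wd; rewrite {2}/defect externally_symmetric_feedthrough subrr addr0.
  by move/eqP; rewrite scaler_eq0 gt_eqF ?(andP wd).1//= expr0 mulmx1 => /eqP.
have step v : 0 < v <= d -> v *: defect (C *m A ^+ k.+1 *m X v *m B) + defect (C *m A ^+ k *m B) = 0.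
  move=> vd; rewrite -defectZ -defectD -(IH _ vd); congr defect.
  rewrite {2}(XE vd) mulmxDr mulmx1 mulmxDl addrC exprSr -mulmxE -scalemxAr -scalemxAl.
  by rewrite !mulmxA.
have Z := defect_small step.
have := step _ wd; rewrite Z addr0 => /eqP.
by rewrite scaler_eq0 gt_eqF ?(andP wd).1//= => /eqP.
Qed.

Let defect_markov k : defect (C *m A ^+ k *m B) = 0.
Proof.
apply: (@defect_small _ (C *m A ^+ k.+1)) => w wd.
rewrite -defectZ -defectD -(defect_markov_resolvent k wd); congr defect.
rewrite {2}(XE wd) mulmxDr mulmx1 mulmxDl addrC exprSr -mulmxE -scalemxAr -scalemxAl.
by rewrite !mulmxA.
Qed.

(** The partial sums of the exponential series are combinations of the Markov
    parameters, and the defect is continuous. *)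
Lemma externally_symmetric_kernel t :
  S *m (C *m expmx (t *: A) *m B)^T = C *m expmx (t *: A) *m B *m S.
Proof.
apply/eqP; rewrite -subr_eq0 -/(defect _).
have [c c0 hc] := defect_bound C; rewrite -normr_eq0; apply/eqP.
apply: (@eq0_of_le_small _ _ c 1) => // e /andP[e0 _].
have /cvgrPdist_le/(_ e e0) := @expmx_partial_cvg K n A t.
case=> N _ /(_ N (leqnn N)); set P := \sum_(_ <= _ < _) _ => /= hN.
have P0 : defect (C *m P *m B) = 0.
  rewrite /P mulmx_sumr mulmx_suml; elim/big_rec: _ => [|k Y _ Y0].
    by rewrite /defect trmx0 mulmx0 mul0mx subrr.
  rewrite defectD Y0 addr0 exprmxZ scalerA -scalemxAr -scalemxAl defectZ.
  by rewrite defect_markov scaler0.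
rewrite -(subr0 (defect _)) -P0 -[defect (C *m P *m B)]opprK.
have -> : - defect (C *m P *m B) = defect (C *m (- P) *m B).
  by rewrite -scaleN1r -defectZ scalemxAl scalemxAr scaleN1r.
rewrite opprK -defectD -mulmxDl -mulmxDr (le_trans (hc _))// ler_wpM2l//.
Qed.
End ExternalSymmetry.

(** * Vector signals and convolution operators *)
Section VectorSignals.
Context {K : realType}.
Local Notation mu := (@lebesgue_measure K).
Implicit Types (T c t : K).

Definition bddmeas_vec q T (u : K -> 'cV[K]_q) : Prop :=
  forall i, bddmeas 0 T (fun t => u t i ord0).

Definition dot q (v w : 'cV[K]_q) : K := (v^T *m w) ord0 ord0.

Lemma dotE q (v w : 'cV[K]_q) : dot v w = \sum_i v i ord0 * w i ord0.
Proof. by rewrite /dot mxE; apply: eq_bigr => i _; rewrite mxE. Qed.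

Lemma dotC q (v w : 'cV[K]_q) : dot v w = dot w v.
Proof. by rewrite !dotE; apply: eq_bigr => i _; rewrite mulrC. Qed.

Lemma dotDl q (v w x : 'cV[K]_q) : dot (v + w) x = dot v x + dot w x.
Proof. by rewrite /dot linearD/= mulmxDl mxE. Qed.

Lemma dotDr q (v w x : 'cV[K]_q) : dot x (v + w) = dot x v + dot x w.
Proof. by rewrite /dot mulmxDr mxE. Qed.

Lemma dotNr q (v x : 'cV[K]_q) : dot x (- v) = - dot x v.
Proof. by rewrite /dot mulmxN mxE. Qed.

Lemma dot_mulmx p q (M : 'M[K]_(p, q)) v w : dot v (M *m w) = dot (M^T *m v) w.
Proof. by rewrite /dot trmx_mul trmxK mulmxA. Qed.

Lemma eq_bddmeas_vec q T (u v : K -> 'cV[K]_q) : {in `[0, T], u =1 v} ->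
  bddmeas_vec T u -> bddmeas_vec T v.
Proof. by move=> uv bu i; apply: eq_bddmeas (bu i) => t tT; rewrite uv. Qed.

Lemma bddmeas_vecD q T (u v : K -> 'cV[K]_q) : bddmeas_vec T u -> bddmeas_vec T v ->
  bddmeas_vec T (fun t => u t + v t).
Proof. by move=> bu bv i; under eq_fun do rewrite mxE; exact: bddmeasD. Qed.

Lemma bddmeas_vec_mulmx p q T (M : 'M[K]_(p, q)) (u : K -> 'cV[K]_q) :
  bddmeas_vec T u -> bddmeas_vec T (fun t => M *m u t).
Proof.
move=> bu i; under eq_fun do rewrite mxE.
by apply: bddmeas_sum => j; exact: bddmeasZ.
Qed.

Lemma bddmeas_vecZ q T a (u : K -> 'cV[K]_q) :
  bddmeas_vec T u -> bddmeas_vec T (fun t => a *: u t).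
Proof. by move=> bu i; under eq_fun do rewrite mxE; exact: bddmeasZ. Qed.

Lemma bddmeas_vecB q T (u v : K -> 'cV[K]_q) : bddmeas_vec T u -> bddmeas_vec T v ->
  bddmeas_vec T (fun t => u t - v t).
Proof.
move=> bu bv; apply: bddmeas_vecD => //.
by under eq_fun do rewrite -scaleN1r; exact: bddmeas_vecZ.
Qed.

Lemma bddmeas_vec_reflection q T (u : K -> 'cV[K]_q) :
  bddmeas_vec T u -> bddmeas_vec T (fun t => u (T - t)).
Proof. by move=> bu i; apply: (@bddmeas_reflection _ T 0 T (fun t => u t i ord0)); rewrite subrr subr0. Qed.

Lemma bddmeas_dot q T (u v : K -> 'cV[K]_q) : bddmeas_vec T u -> bddmeas_vec T v ->
  bddmeas 0 T (fun t => dot (u t) (v t)).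
Proof.
move=> bu bv; under eq_fun do rewrite dotE.
by apply: bddmeas_sum => i; exact: bddmeasM.
Qed.

Lemma bddmeas_vec_bounded q T (u : K -> 'cV[K]_q) : bddmeas_vec T u ->
  exists2 c, 0 <= c & forall t, t \in `[0, T] -> `|u t| <= c.
Proof.
move=> bu; have h i : exists c, forall t, t \in `[0, T] -> `|u t i ord0| <= c by have [] := bu i.
have [c hc] := choice h; exists (\sum_i `|c i|); first by rewrite sumr_ge0.
move=> t tT; apply/mx_norm_leP; first by rewrite sumr_ge0.
move=> i j; rewrite (ord1 j) (le_trans (hc i _ tT))// (le_trans (ler_norm _))//.
by rewrite (bigD1 i)//= lerDl sumr_ge0.
Qed.

(** [io_operator A B C D] is [convop] for the kernel [C exp(tA) B]; leaving the
    kernel free lets the same lemmas apply to the adjoint system and to the state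
    equation. *)
Definition convop p q (H : K -> 'M[K]_(p, q)) (D : 'M[K]_(p, q)) (u : K -> 'cV[K]_q) :
    K -> 'cV[K]_p :=
  fun t => mxintegral `[0, t] (fun r => H (t - r) *m u r) + D *m u t.

Definition kernel_continuous p q (H : K -> 'M[K]_(p, q)) : Prop :=
  forall i j, continuous (fun t => H t i j).

Section ConvolutionOperator.
Context {p q : nat}.
Variables (H : K -> 'M[K]_(p, q)) (D : 'M[K]_(p, q)) (T : K).
Hypotheses (cH : kernel_continuous H).

Lemma convop_entry (u : K -> 'cV[K]_q) t i : bddmeas_vec T u -> t \in `[0, T] ->
  convop H D u t i ord0 = \sum_j convolve (fun s => H s i j) (fun s => u s j ord0) t +
                          \sum_j D i j * u t j ord0.
Proof.
rewrite in_itv/= => bu /andP[t0 tT]; rewrite mxE; congr (_ + _); last by rewrite mxE.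
rewrite mxE -Rintegral_sum; last first.
  by move=> j; exact: (bddmeas_convolve_integrand tT (@cH i j) (bu j)).
by apply: eq_Rintegral => r _; rewrite mxE.
Qed.

Lemma bddmeas_convop (u : K -> 'cV[K]_q) : bddmeas_vec T u -> bddmeas_vec T (convop H D u).
Proof.
move=> bu i; apply: (@eq_bddmeas _ _ _ (fun t =>
    \sum_j convolve (fun s => H s i j) (fun s => u s j ord0) t +
    \sum_j D i j * u t j ord0)) => [t tT|]; first exact/esym/convop_entry.
apply: bddmeasD; apply: bddmeas_sum => j; last exact: bddmeasZ.
by apply: bddmeas_convolve => //; exact: cH.
Qed.

Lemma convopB (u v : K -> 'cV[K]_q) t : bddmeas_vec T u -> bddmeas_vec T v -> t \in `[0, T] ->
  convop H D (fun s => u s - v s) t = convop H D u t - convop H D v t.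
Proof.
move=> bu bv tT; apply/colP => i; have bw := bddmeas_vecB bu bv.
rewrite [RHS]mxE [X in _ = _ + X]mxE !convop_entry//.
rewrite opprD addrACA -!sumrB; congr (_ + _); apply: eq_bigr => j _; last first.
  by rewrite !mxE mulrBr.
have [_ tT'] := andP tT; rewrite /convolve -RintegralB//.
- by apply: eq_Rintegral => s _; rewrite !mxE mulrBr.
- exact/bddmeas_integrable/(bddmeas_convolve_integrand tT' (@cH i j) (bu j)).
- exact/bddmeas_integrable/(bddmeas_convolve_integrand tT' (@cH i j) (bv j)).
Qed.

(** The peak-to-peak estimate: [g] bounds the row sums of the kernel, with the
    feedthrough counted as a point mass at 0. *)
Lemma convop_bound (u : K -> 'cV[K]_q) (g c : K) t : 0 <= g -> 0 <= c ->
  (forall i, \sum_j (`|D i j| + \int[mu]_(s in `[0, T]) `|H s i j|) <= g) ->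
  bddmeas_vec T u -> (forall s, s \in `[0, T] -> `|u s| <= c) -> t \in `[0, T] ->
  `|convop H D u t| <= g * c.
Proof.
move=> g0 c0 hg bu uc tT; apply/mx_norm_leP => [|i j]; first exact: mulr_ge0.
rewrite (ord1 j) convop_entry// -big_split/= (le_trans (ler_norm_sum _ _ _))//.
apply: (@le_trans _ _ (\sum_j (`|D i j| + \int[mu]_(s in `[0, T]) `|H s i j|) * c)).
  apply: ler_sum => l _; rewrite (le_trans (ler_normD _ _))// addrC mulrDl lerD//.
    by rewrite normrM ler_wpM2l// (le_trans (mx_norm_entry _ _ _))// uc.
  rewrite mulrC (convolve_bound (@cH i l) (bu l))//.
  by move=> s sT; rewrite (le_trans (mx_norm_entry _ _ _))// uc.
by rewrite -mulr_suml ler_wpM2r.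
Qed.

(** The integral is blind to null sets, the feedthrough is not: this is what
    remains at each point when the input changes on a null set. *)
Lemma convop_ae_eq (u v : K -> 'cV[K]_q) t :
  (forall i, measurable_fun `[0, T] (fun s => u s i ord0)) -> bddmeas_vec T v ->
  {ae mu, forall s, s \in `[0, T] -> u s = v s} -> t \in `[0, T] ->
  convop H D u t = convop H D v t + D *m (u t - v t).
Proof.
move=> meas_u bv uv tT; rewrite /convop mulmxBr -addrA; congr (_ + _); last by rewrite addrC subrK.
apply/matrixP => i j; rewrite !mxE.
have [_ tT'] := andP tT; rewrite /= in tT'.
have cHr l : measurable_fun `[0, t] (fun r => H (t - r) i l).
  have bH := bddmeas_continuous (t - t) (t - 0) (@cH i l).
  by have [] := bddmeas_reflection bH.
have sub : `[0, t] `<=` `[0, T].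
  by apply: subset_itv; rewrite bnd_simp.
have M (x : K -> 'cV[K]_q) : (forall i, measurable_fun `[0, T] (fun s => x s i ord0)) ->
    measurable_fun `[0, t] (fun r => (H (t - r) *m x r) i j).
  move=> mx; rewrite (_ : (fun r => _) = fun r => \sum_l H (t - r) i l * x r l j); last first.
    by apply/funext => r; rewrite mxE.
  apply: measurable_sum => l; apply: measurable_funM; first exact: cHr.
  by rewrite (ord1 j); apply: measurable_funS (mx l).
apply: ae_eq_Rintegral.
- exact: M.
- by apply: M => l; have [] := bv l.
- apply: filterS uv; first exact: (ae_filter_ringOfSetsType mu).
  by move=> r h rt; rewrite h//; exact: sub.
Qed.
End ConvolutionOperator.

(** The adjoint of a causal convolution operator is the operator of the transposed
    kernel, run backwards in time. *)
Lemma convop_adjoint (p q : nat) (H : K -> 'M[K]_(p, q)) (D : 'M[K]_(p, q)) T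
    (u : K -> 'cV[K]_q) (w : K -> 'cV[K]_p) : kernel_continuous H -> 0 <= T ->
  bddmeas_vec T u -> bddmeas_vec T w ->
  \int[mu]_(t in `[0, T]) dot (w t) (convop H D u t) =
  \int[mu]_(t in `[0, T])
     dot (convop (fun s => (H s)^T) D^T (fun s => w (T - s)) (T - t)) (u t).
Proof.
move=> cH T0 bu bw.
pose e i j t := w t i ord0 * convolve (fun s => H s i j) (fun s => u s j ord0) t.
pose e' i j t :=
  convolve (fun s => H s i j) (fun s => w (T - s) i ord0) (T - t) * u t j ord0.
pose d t := dot (D^T *m w t) (u t).
have bwr := bddmeas_vec_reflection bw.
have bd : bddmeas 0 T d by apply: bddmeas_dot => //; exact: bddmeas_vec_mulmx.
have be i j : bddmeas 0 T (e i j).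
  by apply: bddmeasM; [exact: bw|apply: bddmeas_convolve; [exact: cH|exact: bu]].
have be' i j : bddmeas 0 T (e' i j).
  apply: bddmeasM; last exact: bu.
  apply: (@bddmeas_reflection _ T 0 T (convolve _ _)); rewrite subrr subr0.
  by apply: bddmeas_convolve; [exact: cH|exact: bwr].
rewrite (@eq_Rintegral _ _ _ mu _ (fun t => \sum_i \sum_j e i j t + d t)); last first.
  move=> t; rewrite inE/= => tT; rewrite dotE.
  transitivity (\sum_i (\sum_j e i j t + w t i ord0 * (D *m u t) i ord0)).
    apply: eq_bigr => i _; rewrite (convop_entry D cH i bu tT) mulrDr; congr (_ + _).
      by rewrite mulr_sumr.
    by rewrite [in RHS]mxE.
  by rewrite big_split/= -dotE dot_mulmx.
rewrite [RHS](@eq_Rintegral _ _ _ mu _ (fun t => \sum_i \sum_j e' i j t + d t)); last first.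
  move=> t; rewrite inE/= => tT; rewrite dotE.
  have TtT : T - t \in `[0, T] by move: tT; rewrite !in_itv/=; lra.
  have cHt : kernel_continuous (fun s => (H s)^T).
    by move=> i j; under eq_fun do rewrite mxE; exact: cH.
  transitivity (\sum_j (\sum_i e' i j t + (D^T *m w t) j ord0 * u t j ord0)).
    apply: eq_bigr => j _; rewrite (convop_entry _ cHt j bwr TtT) mulrDl; congr (_ + _).
      rewrite mulr_suml; apply: eq_bigr => i _; congr (_ * _).
      by congr (convolve _ _ _); apply/funext => s; rewrite mxE.
    by rewrite subKr [in RHS]mxE.
  by rewrite big_split/= -dotE exchange_big.
have bs (F : 'I_p -> 'I_q -> K -> K) : (forall i j, bddmeas 0 T (F i j)) ->
    bddmeas 0 T (fun t => \sum_i \sum_j F i j t).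
  by move=> bF; apply: bddmeas_sum => i; exact: bddmeas_sum.
have ibd := bddmeas_integrable bd.
have [ie ie'] := (bddmeas_integrable (bs _ be), bddmeas_integrable (bs _ be')).
rewrite !RintegralD//; congr (_ + _).
rewrite (Rintegral_sum _ (fun i => bddmeas_sum _ (be i))).
rewrite (Rintegral_sum _ (fun i => bddmeas_sum _ (be' i))).
apply: eq_bigr => i _; rewrite (Rintegral_sum _ (be i)) (Rintegral_sum _ (be' i)).
apply: eq_bigr => j _.
exact: convolve_adjoint T0 (bw i) (@cH i j) (bu j).
Qed.


End VectorSignals.

(** * Trajectories of the state equation *)
Section Calculus.
Context {K : realType}.
Local Notation mu := (@lebesgue_measure K).
Implicit Types (a b c t T : K).

Lemma Rintegral_is_derive (F f : K -> K) a b : a <= b -> continuous f ->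
  (forall x, is_derive x (1 : K) F (f x)) ->
  \int[mu]_(t in `[a, b]) f t = F b - F a.
Proof.
rewrite le_eqVlt => /predU1P[<- _ _|ab cf dF].
  by rewrite subrr set_itv1 Rintegral_set1.
have cF : continuous F.
  move=> x; apply: differentiable_continuous; apply/derivable1_diffP.
  by have [] := dF x.
have dFE x : derive1 F x = f x by rewrite derive1E; have [_ ->] := dF x.
rewrite /Rintegral (@continuous_FTC2 _ f F)//.
- exact: continuous_subspaceT.
- split.
  + by move=> x _; have [] := dF x.
  + exact/cvg_at_right_filter/cF.
  + exact/cvg_at_left_filter/cF.
Qed.

(** The integrated form of [(k * f)' = k' * f + k(0) f].  Since [f] is only
    measurable, [k * f] need not be differentiable; exchanging the integrals puts
    the integration in time on the smooth kernel alone. *)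
Lemma Rintegral_convolve_derive (k k' f : K -> K) T t :
  continuous k' -> (forall x, is_derive x (1 : K) k (k' x)) -> bddmeas 0 T f ->
  t \in `[0, T] ->
  \int[mu]_(s in `[0, t]) convolve k' f s =
  convolve k f t - k 0 * \int[mu]_(s in `[0, t]) f s.
Proof.
move=> ck' dk bf; rewrite in_itv/= => /andP[t0 tT].
have ck : continuous k.
  move=> x; apply: differentiable_continuous; apply/derivable1_diffP.
  by have [] := dk x.
have bft : bddmeas 0 t f by exact: bddmeas_sub bf.
have [_ E] := convolve_swap t0 (bddmeas_cst 0 t 1) ck' bft.
under [LHS]eq_Rintegral do rewrite -[convolve _ _ _]mul1r.
rewrite [LHS]E -RintegralZl//; last exact: bddmeas_integrable.
rewrite /convolve -RintegralB//; first last.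
- exact/bddmeas_integrable/bddmeasZ.
- exact/bddmeas_integrable/(bddmeas_convolve_integrand (lexx t)).
apply: eq_Rintegral => r; rewrite inE/= in_itv/= => /andP[r0 rt].
rewrite -mulrBl; congr (_ * _).
under eq_Rintegral do rewrite mul1r.
transitivity (k (t - r) - k (r - r)); last by rewrite subrr.
apply: (Rintegral_is_derive (F := fun s => k (s - r))) => // [s|s].
  apply: continuous_comp; last exact: ck'.
  by apply: cvgB; [exact: cvg_id|exact: cvg_cst].
rewrite -[k' _]mulr1; apply: (@is_derive1_comp _ k (shift (- r))).
exact: is_derive_shift.
Qed.
End Calculus.

Section ConvopMulmx.
Context {K : realType}.
Local Notation mu := (@lebesgue_measure K).

Lemma mxintegral_mulmx (p q r : nat) (M : 'M[K]_(r, p)) (a b : K) (F : K -> 'M[K]_(p, q)) :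
  (forall i j, bddmeas a b (fun t => F t i j)) ->
  M *m mxintegral `[a, b] F = mxintegral `[a, b] (fun t => M *m F t).
Proof.
move=> bF; apply/matrixP => i j; rewrite !mxE.
under eq_bigr => l _ do rewrite mxE.
rewrite [RHS](@eq_Rintegral _ _ _ mu _ (fun t => \sum_l M i l * F t l j)).
  rewrite Rintegral_sum; last by move=> l; exact: bddmeasZ.
  by apply: eq_bigr => l _; rewrite RintegralZl//; exact: bddmeas_integrable.
by move=> t _; rewrite mxE.
Qed.

Lemma mxintegralD (p q : nat) (a b : K) (F G : K -> 'M[K]_(p, q)) :
  (forall i j, bddmeas a b (fun t => F t i j)) ->
  (forall i j, bddmeas a b (fun t => G t i j)) ->
  mxintegral `[a, b] (fun t => F t + G t) = mxintegral `[a, b] F + mxintegral `[a, b] G.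
Proof.
move=> bF bG; apply/matrixP => i j; rewrite !mxE -RintegralD//; try exact: bddmeas_integrable.
by apply: eq_Rintegral => t _; rewrite mxE.
Qed.

Lemma mulmx_convop (p q r : nat) (M : 'M[K]_(r, p)) (H : K -> 'M[K]_(p, q)) (D : 'M[K]_(p, q))
    T (u : K -> 'cV[K]_q) t : kernel_continuous H -> bddmeas_vec T u -> t \in `[0, T] ->
  M *m convop H D u t = convop (fun s => M *m H s) (M *m D) u t.
Proof.
move=> cH bu; rewrite in_itv/= => /andP[t0 tT].
rewrite /convop mulmxDr mulmxA; congr (_ + _); rewrite mxintegral_mulmx.
  by congr mxintegral; apply/funext => s; rewrite mulmxA.
move=> i j; rewrite (ord1 j) (_ : (fun s => _) = fun s => \sum_l H (t - s) i l * u s l ord0).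
  by apply: bddmeas_sum => l; exact: bddmeas_convolve_integrand tT (@cH i l) (bu l).
by apply/funext => s; rewrite mxE.
Qed.

Lemma within_continuous_mx (p q : nat) (A : set K) (F : K -> 'M[K]_(p, q)) :
  (forall i j, {within A, continuous (fun t => F t i j)}) -> {within A, continuous F}.
Proof. by move=> cF t; apply: cvg_mx_entries => i j; exact: cF. Qed.

Lemma within_continuous_entry (p q : nat) (A : set K) (F : K -> 'M[K]_(p, q)) i j :
  {within A, continuous F} -> {within A, continuous (fun t => F t i j)}.
Proof. by move=> cF t; exact: cvg_comp (cF t) (@coord_continuous _ _ _ i j _). Qed.
End ConvopMulmx.

Section Trajectories.
Context {K : realType} {n m : nat}.
Local Notation mu := (@lebesgue_measure K).
Variables (A : 'M[K]_n) (B : 'M[K]_(n, m)) (C : 'M[K]_(m, n)) (D : 'M[K]_m).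
Variables (T : K) (x0 : 'cV[K]_n).

Let E : K -> 'M[K]_n := fun t => expmx (t *: A).

Let cE : kernel_continuous E.
Proof. by move=> i j; exact: continuous_expmx. Qed.

Let cAE : kernel_continuous (fun t => A *m E t).
Proof.
move=> i j; rewrite (_ : (fun t => _) = fun t => \sum_l A i l * E t l j); last first.
  by apply/funext => t; rewrite mxE.
move=> t; apply: cvg_big => [|l _]; first exact: add_continuous.
by apply: cvgM; [exact: cvg_cst|exact: cE].
Qed.

(** Variation of constants. *)
Definition state_response (u : K -> 'cV[K]_m) : K -> 'cV[K]_n :=
  fun t => E t *m x0 + convop E 0 (fun r => B *m u r) t.

Lemma kernel_continuous_impulse :
  kernel_continuous (fun t => C *m expmx (t *: A) *m B).
Proof.
move=> i j; rewrite (_ : (fun t => _) = fun t => \sum_l \sum_p C i p * E t p l * B l j).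
  move=> t; apply: cvg_big => [|l _]; first exact: add_continuous.
  apply: cvg_big => [|p _]; first exact: add_continuous.
  apply: cvgM; last exact: cvg_cst.
  by apply: cvgM; [exact: cvg_cst|exact: cE].
by apply/funext => t; rewrite mxE; apply: eq_bigr => l _; rewrite mxE mulr_suml.
Qed.

Variable u : K -> 'cV[K]_m.
Hypothesis bu : bddmeas_vec T u.

Let bBu : bddmeas_vec T (fun r => B *m u r).
Proof. exact: bddmeas_vec_mulmx. Qed.

Let bEx0 : bddmeas_vec T (fun t => E t *m x0).
Proof.
move=> i; under eq_fun do rewrite mxE.
apply: bddmeas_sum => l; apply: bddmeasM; last exact: bddmeas_cst.
by apply: bddmeas_continuous; exact: cE.
Qed.

Let state_integral t : t \in `[0, T] ->
  state_response u t = x0 + mxintegral `[0, t] (fun r => A *m state_response u r + B *m u r).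
Proof.
move=> tT; have [t0 tT'] := andP tT; rewrite /= in t0 tT'.
have sub r : r \in `[0, t] -> r \in `[0, T].
  by rewrite !in_itv/= => /andP[-> /le_trans]; exact.
apply/colP => i; rewrite [RHS]mxE [X in _ = _ + X]mxE.
have bAE l : bddmeas 0 t (fun r => (A *m E r) i l) by apply: bddmeas_continuous; exact: cAE.
pose v r := B *m u r.
have bv l : bddmeas 0 T (fun r => v r l ord0) by exact: bBu.
have bvt l : bddmeas 0 t (fun r => v r l ord0) by apply: bddmeas_sub (bv l).
pose c l r := convolve (fun s => (A *m E s) i l) (fun s => v s l ord0) r.
have bc l : bddmeas 0 t (c l) by apply: bddmeas_convolve (bvt l); exact: cAE.
rewrite (@eq_Rintegral _ _ _ mu _ (fun r => \sum_l (A *m E r) i l * x0 l ord0 +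
    (\sum_l c l r + v r i ord0))); last first.
  move=> r; rewrite inE/= => /sub rT.
  rewrite /state_response mulmxDr mulmxA (mulmx_convop A 0 cE bBu rT) mulmx0.
  rewrite [LHS]mxE [X in X + _]mxE -addrA; congr (_ + _); first by rewrite mxE.
  rewrite (convop_entry 0 cAE i bBu rT) [X in _ + X + _]big1 ?addr0// => l _.
  by rewrite mxE mul0r.
have b1 : bddmeas 0 t (fun r => \sum_l (A *m E r) i l * x0 l ord0).
  by apply: bddmeas_sum => l; apply: bddmeasM => //; exact: bddmeas_cst.
have b2 : bddmeas 0 t (fun r => \sum_l c l r) by exact: bddmeas_sum.
rewrite RintegralD//; [|exact: bddmeas_integrable|exact/bddmeas_integrable/bddmeasD].
rewrite RintegralD//; [|exact: bddmeas_integrable|exact: bddmeas_integrable].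
rewrite Rintegral_sum; last by move=> l; apply: bddmeasM => //; exact: bddmeas_cst.
rewrite Rintegral_sum//.
rewrite /state_response [LHS]mxE (convop_entry 0 cE i bBu tT).
have E0 l : E 0 i l = (i == l)%:R by rewrite /E expmx0 mxE.
rewrite [X in _ + (_ + X) = _]big1 ?addr0; last by move=> l _; rewrite mxE mul0r.
have -> : \sum_l \int[mu]_(r in `[0, t]) c l r =
   \sum_l convolve (fun s => E s i l) (fun s => v s l ord0) t - \int[mu]_(r in `[0, t]) v r i ord0.
  under eq_bigr => l _ do rewrite (Rintegral_convolve_derive (@cAE i l) (fun s => is_derive_expmx A s i l) (bv l) tT) -/E E0.
  rewrite sumrB; congr (_ - _); rewrite (bigD1 i)//= eqxx mul1r big1 ?addr0// => l li.
  by rewrite eq_sym (negbTE li) mul0r.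
have -> : \sum_l \int[mu]_(r in `[0, t]) ((A *m E r) i l * x0 l ord0) =
   (E t *m x0) i ord0 - x0 i ord0.
  rewrite mxE.
  transitivity (\sum_l ((E t i l - (i == l)%:R) * x0 l ord0)).
    apply: eq_bigr => l _; rewrite RintegralZr//; last exact: bddmeas_integrable.
    rewrite (Rintegral_is_derive t0 (@cAE i l) (fun s => is_derive_expmx A s i l)).
    by rewrite -/(E 0) E0.
  under eq_bigr do rewrite mulrBl.
  rewrite sumrB; congr (_ - _); rewrite (bigD1 i)//= eqxx mul1r big1 ?addr0// => l li.
  by rewrite eq_sym (negbTE li) mul0r.
ring.
Qed.

Let b_state : bddmeas_vec T (state_response u).
Proof. by apply: bddmeas_vecD => //; exact: bddmeas_convop. Qed.

Lemma trajectory_response : 0 <= T ->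
  trajectory A B C D T x0 u (state_response u)
    (io_operator A B C D u \+ free_response A C x0).
Proof.
move=> T0; split; last 1 first.
- move=> t tT; rewrite /state_response mulmxDr (mulmx_convop C 0 cE bBu tT) mulmx0.
  rewrite /convop mul0mx addr0 mulmxA -addrA addrC; congr (_ + _).
  rewrite /io_operator; congr (_ + _); congr mxintegral; apply/funext => r.
  by rewrite !mulmxA.
- apply: within_continuous_mx => i j; rewrite (ord1 j).
  pose g r := (A *m state_response u r + B *m u r) i ord0.
  have bg : bddmeas 0 T g.
    by apply: (@bddmeas_vecD _ _ _ (fun r => A *m _) _ _ bBu i); exact: bddmeas_vec_mulmx.
  have : {within `[0, T], continuous (fun t => x0 i ord0 + \int[mu]_(r in `[0, t]) g r)}.
    move=> t; apply: cvgD; first exact: cvg_cst.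
    exact: (parameterized_integral_continuous T0 (bddmeas_integrable bg)).
  apply: subspace_eq_continuous => t; rewrite inE/= => tT.
  by rewrite /from_subspace (state_integral tT) [RHS]mxE [X in _ = _ + X]mxE.
- by move=> t tT; rewrite {1}state_integral.
Qed.

(** The difference [z] of two trajectories satisfies [z t = \int_0^t A z].  Let [W]
    be the maximum of [exp(- l t) |z t|], attained at [c].  If [l] is twice a bound
    for [A], integrating [|z| <= W exp(l t)] gives [|z c| <= W / 2 * exp(l c)], that
    is [W <= W / 2]. *)
Lemma trajectory_unique x y x' y' : 0 <= T ->
  trajectory A B C D T x0 u x y -> trajectory A B C D T x0 u x' y' ->
  {in `[0, T], x =1 x'}.
Proof.
move=> T0 [cx ix _] [cx' ix' _].
have bx i : bddmeas 0 T (fun t => x t i ord0).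
  by apply: bddmeas_within; exact: within_continuous_entry.
have bx' i : bddmeas 0 T (fun t => x' t i ord0).
  by apply: bddmeas_within; exact: within_continuous_entry.
pose z t := x t - x' t.
have bz : bddmeas_vec T z by exact: bddmeas_vecB.
have bAz : bddmeas_vec T (fun t => A *m z t) by exact: bddmeas_vec_mulmx.
have zE t : t \in `[0, T] -> z t = mxintegral `[0, t] (fun r => A *m z r).
  move=> tT; have [_ tT'] := andP tT; rewrite /= in tT'.
  have sub f : bddmeas 0 T f -> bddmeas 0 t f by exact: bddmeas_sub.
  have M (w : K -> 'cV[K]_n) i j : (forall i, bddmeas 0 T (fun t => w t i ord0)) ->
      bddmeas 0 t (fun r => (A *m w r) i j).
    by move=> bw; apply: sub; rewrite (ord1 j); exact: (@bddmeas_vec_mulmx _ _ _ _ A w bw i).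
  have Mu i j : bddmeas 0 t (fun r => (B *m u r) i j) by apply: sub; rewrite (ord1 j).
  rewrite /z ix// ix'// !mxintegralD => [|i j|//|i j|//]; try exact: M.
  rewrite opprD addrACA subrr add0r opprD addrACA subrr addr0.
  apply/matrixP => i j; rewrite !mxE -RintegralB//; try exact/bddmeas_integrable/M.
  by apply: eq_Rintegral => r _; rewrite mulmxBr !mxE.
(* [k] bounds the operator [A]; the summand 1 only keeps it positive. *)
pose k : K := n%:R * `|A| + 1; pose l : K := 2 * k.
have k0 : 0 < k by rewrite ltr_wpDl// mulr_ge0.
have l0 : 0 < l by rewrite mulr_gt0.
have cexp (a : K) : continuous (fun t => expR (a * t)).
  move=> t; apply: continuous_comp; last exact: continuous_expR.
  by apply: cvgM; [exact: cvg_cst|exact: cvg_id].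
have cphi : {within `[0, T], continuous (fun t => expR (- l * t) * `|z t|)}.
  move=> t; apply: cvgM; first by apply: continuous_subspaceT; exact: cexp.
  by apply: cvg_norm; apply: cvgB; [exact: cx|exact: cx'].
have [c cT Wmax] := EVT_max T0 cphi.
set W := expR (- l * c) * `|z c| in Wmax.
have W0 : 0 <= W by rewrite mulr_ge0// expR_ge0.
have zW t : t \in `[0, T] -> `|z t| <= W * expR (l * t).
  move=> /Wmax; rewrite -(ler_pM2r (expR_gt0 (l * t))) mulrAC -expRD.
  by rewrite mulNr addNr expR0 mul1r.
have half : `|z c| <= W / 2 * expR (l * c).
  have [c0 cT'] := andP cT; rewrite /= in c0 cT'.
  apply/mx_norm_leP => [|i j]; first by rewrite mulr_ge0 ?divr_ge0// expR_ge0.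
  rewrite zE// mxE (ord1 j).
  have bi : bddmeas 0 c (fun r => (A *m z r) i ord0) by exact: bddmeas_sub (bAz i).
  apply: (le_trans (le_normr_Rintegral _ (bddmeas_integrable bi))) => //.
  have cg : continuous (fun r => k * W * expR (l * r)).
    by move=> r; apply: cvgM; [exact: cvg_cst|exact: cexp].
  apply: (@le_trans _ _ (\int[mu]_(r in `[0, c]) (k * W * expR (l * r)))).
    apply: le_Rintegral => //.
    - exact/bddmeas_integrable/bddmeas_norm.
    - exact/bddmeas_integrable/bddmeas_continuous.
    - move=> r rc; rewrite (le_trans (mx_norm_entry _ _ _))// (le_trans (mx_norm_mulmx _ _))//.
      rewrite -[leRHS]mulrA ler_pM// ?mulr_ge0//; first by rewrite lerDl.
      by rewrite zW//; move: rc; rewrite /= !in_itv/= => /andP[-> /le_trans]; exact.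
  have dexp r : is_derive r (1 : K) (fun r => W / 2 * expR (l * r)) (k * W * expR (l * r)).
    have d1 : is_derive r (1 : K) (l \*: (id : K -> K)) (l *: 1) by exact: is_deriveZ.
    have d2 := is_derive1_comp (is_derive_expR (l * r)) d1.
    have := is_deriveZ (W / 2) d2; move=> /is_derive_eq; apply.
    by rewrite /l /GRing.scale/=; field.
  rewrite (Rintegral_is_derive c0 cg dexp).
  by rewrite mulr0 expR0 mulr1 lerBlDr lerDl divr_ge0.
have Wz : `|z c| = W * expR (l * c).
  by rewrite /W mulrAC -expRD mulNr addNr expR0 mul1r.
have W00 : W = 0.
  apply/eqP; rewrite eq_le W0 andbT; move: half; rewrite Wz ler_pM2r ?expR_gt0//.
  lra.
move=> t tT; apply/eqP; rewrite -subr_eq0 -normr_eq0 eq_le normr_ge0 andbT.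
by rewrite (le_trans (zW _ tT))// W00 mul0r.
Qed.
End Trajectories.

(** * Contractions on bounded measurable signals *)
Section FixedPoint.
Context {K : realType} {p : nat}.
Implicit Types (u v : K -> 'cV[K]_p) (T c : K).

Lemma le0_of_le_geometric (x c rho : K) : 0 <= rho < 1 ->
  (forall k, x <= c * rho ^+ k) -> x <= 0.
Proof.
move=> /andP[r0 r1] h.
have g : (fun k => c * rho ^+ k) @ \oo --> (0 : K).
  by apply: cvg_geometric; rewrite ger0_norm.
apply: (cvgr_to_ge g); exact: nearW.
Qed.

(** The iterates converge geometrically at every point of [[0, T]], uniformly in
    the point.  The fixed point is their pointwise limit, which is measurable and
    bounded at once. *)
Lemma contraction_fixed_point T (F : (K -> 'cV[K]_p) -> K -> 'cV[K]_p) (rho : K) :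
  0 <= rho < 1 ->
  (forall u, bddmeas_vec T u -> bddmeas_vec T (F u)) ->
  (forall u v c, bddmeas_vec T u -> bddmeas_vec T v -> 0 <= c ->
     (forall t, t \in `[0, T] -> `|u t - v t| <= c) ->
     forall t, t \in `[0, T] -> `|F u t - F v t| <= rho * c) ->
  exists2 w, bddmeas_vec T w & {in `[0, T], F w =1 w}.
Proof.
move=> /[dup] rho01 /andP[r0 r1] bF cF; pose v k := iter k F (cst 0).
have bv k : bddmeas_vec T (v k).
  elim: k => [|k IH]; last exact: bF.
  by move=> i; rewrite /v/=; under eq_fun do rewrite mxE; exact: bddmeas_cst.
have [c c0 hc] := bddmeas_vec_bounded (bddmeas_vecB (bv 1%N) (bv 0%N)).
have step k t : t \in `[0, T] -> `|v k.+1 t - v k t| <= c * rho ^+ k.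
  elim: k t => [|k IH] t tT; first by rewrite expr0 mulr1 hc.
  rewrite exprS mulrCA; apply: (cF (v k.+1) (v k)) => //.
  by rewrite mulr_ge0// exprn_ge0.
pose b := c / (1 - rho).
have b0 : 0 <= b by rewrite divr_ge0// subr_ge0 ltW.
(* The factor [1 - rho ^+ j] in the proof is what makes the induction on [j] exact. *)
have far k j t : t \in `[0, T] -> `|v (k + j)%N t - v k t| <= b * rho ^+ k.
  move=> tT; suff : `|v (k + j)%N t - v k t| <= b * rho ^+ k * (1 - rho ^+ j).
    move=> /le_trans; apply; apply: ler_piMr; first by rewrite mulr_ge0// exprn_ge0.
    by rewrite lerBlDr lerDl exprn_ge0.
  elim: j => [|j IH]; first by rewrite addn0 subrr normr0 expr0 subrr mulr0.
  rewrite -(subrK (v (k + j)%N t) (v (k + j.+1)%N t)) -addrA.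
  rewrite (le_trans (ler_normD _ _))//.
  apply: (le_trans (lerD (_ : _ <= c * rho ^+ (k + j)) IH)).
    by rewrite addnS step.
  rewrite le_eqVlt; apply/orP; left; apply/eqP.
  by rewrite /b exprD exprS; field; rewrite subr_eq0 gt_eqF.
have vcvg t i : t \in `[0, T] -> cvgn (fun k => v k t i ord0).
  move=> tT; set a := fun k => _.
  have : cvgn (series (telescope a)).
    apply: normed_cvg; apply: (@series_le_cvg _ _ (geometric c rho)).
    - by move=> k; exact: normr_ge0.
    - by move=> k; rewrite /= mulr_ge0 ?exprn_ge0.
    - move=> k; rewrite /= /telescope /a (le_trans _ (step k t tT))//.
      by have := mx_norm_entry (v k.+1 t - v k t) i ord0; rewrite !mxE.
    - by apply: is_cvg_geometric_series; rewrite ger0_norm.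
  move=> h; have -> : a = (fun k => a 0%N + series (telescope a) k).
    by apply/funext => k; exact: eq_sum_telescope.
  by apply: is_cvgD => //; exact: is_cvg_cst.
pose w t : 'cV[K]_p := \col_i limn (fun k => v k t i ord0).
have wv k t : t \in `[0, T] -> `|w t - v k t| <= b * rho ^+ k.
  move=> tT; apply/mx_norm_leP => [|i j]; first by rewrite mulr_ge0// exprn_ge0.
  rewrite (ord1 j) !mxE.
  have h := vcvg t i tT.
  have {}h : (fun j => `|v (k + j)%N t i ord0 - v k t i ord0|) @ \oo -->
     `|limn (fun k => v k t i ord0) - v k t i ord0|.
    apply: cvg_norm; apply: cvgB; last exact: cvg_cst.
    have : (fun j => v (j + k)%N t i ord0) @ \oo --> limn (fun k => v k t i ord0).
      by rewrite (cvg_shiftn k (fun j => v j t i ord0)).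
    by under eq_fun do rewrite addnC.
  apply: (cvgr_to_le h); apply: nearW => l; rewrite (le_trans _ (far k l t tT))//.
  by have := mx_norm_entry (v (k + l)%N t - v k t) i ord0; rewrite !mxE.
have bw : bddmeas_vec T w.
  move=> i; split.
    apply: (measurable_fun_cvg (h := fun k t => v k t i ord0)).
      by move=> k; have [] := bv k i.
    by move=> t tT; rewrite mxE; exact: vcvg.
  exists b => t tT; have := wv 0%N t tT; rewrite subr0 expr0 mulr1.
  by apply: le_trans; exact: mx_norm_entry.
exists w => // t tT; apply/eqP; rewrite -subr_eq0 -normr_le0.
apply: (@le0_of_le_geometric _ (2 * b) rho) => // k.
rewrite -(subrK (v k.+1 t) (F w t)) -addrA (le_trans (ler_normD _ _))// mulrDl mul1r mulrDl.
have h1 : `|F w t - v k.+1 t| <= rho * (b * rho ^+ k).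
  apply: (cF w (v k)) => //; first by rewrite mulr_ge0// exprn_ge0.
  by move=> s sT; exact: wv.
have h2 := wv k.+1 t tT; rewrite distrC in h2; rewrite lerD//.
  apply: (le_trans h1); apply: ler_piMl; last exact: ltW.
  by rewrite mulr_ge0// exprn_ge0.
by rewrite (le_trans h2)// ler_wpM2l// exprS; apply: ler_piMl; [exact: exprn_ge0|exact: ltW].
Qed.

End FixedPoint.

(** * Essentially bounded signals *)
Section Representatives.
Context {K : realType}.
Local Notation mu := (@lebesgue_measure K).
Implicit Types (T c t : K).

Definition meas_vec q T (u : K -> 'cV[K]_q) : Prop :=
  forall i, measurable_fun `[0, T] (fun t => u t i ord0).

(** [u] is any measurable signal and [v] a representative of its class that is
    bounded at every point.  Measurability of [u] is part of the relation because
    integrals of a.e. equal functions are compared only for measurable ones. *)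
Definition ae_rep q T (u v : K -> 'cV[K]_q) : Prop :=
  [/\ meas_vec T u, bddmeas_vec T v
    & {ae mu, forall t, t \in `[0, T] -> u t = v t}].

Lemma meas_vecD q T (u v : K -> 'cV[K]_q) : meas_vec T u -> meas_vec T v ->
  meas_vec T (fun t => u t + v t).
Proof. by move=> hu hv i; under [X in measurable_fun _ X]eq_fun do rewrite mxE; exact: measurable_funD. Qed.

Lemma meas_vec_mulmx p q T (M : 'M[K]_(p, q)) (u : K -> 'cV[K]_q) :
  meas_vec T u -> meas_vec T (fun t => M *m u t).
Proof.
move=> hu i; under [X in measurable_fun _ X]eq_fun do rewrite mxE.
by apply: measurable_sum => j; apply: measurable_funM => //; exact: measurable_cst.
Qed.

Lemma meas_vecB q T (u v : K -> 'cV[K]_q) : meas_vec T u -> meas_vec T v ->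
  meas_vec T (fun t => u t - v t).
Proof.
move=> hu hv i; under [X in measurable_fun _ X]eq_fun do rewrite !mxE.
exact: measurable_funB.
Qed.

Lemma measurable_dot q T (u v : K -> 'cV[K]_q) : meas_vec T u -> meas_vec T v ->
  measurable_fun `[0, T] (fun t => dot (u t) (v t)).
Proof.
move=> hu hv; under [X in measurable_fun _ X]eq_fun do rewrite dotE.
by apply: measurable_sum => i; exact: measurable_funM.
Qed.

Lemma bddmeas_meas_vec q T (u : K -> 'cV[K]_q) : bddmeas_vec T u -> meas_vec T u.
Proof. by move=> hu i; have [] := hu i. Qed.

Lemma ae_rep_refl q T (u : K -> 'cV[K]_q) : bddmeas_vec T u -> ae_rep T u u.
Proof.
move=> bu; split => //; first exact: bddmeas_meas_vec.
by apply: (aeW mu).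
Qed.

Lemma ae_rep_mulmx p q T (M : 'M[K]_(p, q)) (u v : K -> 'cV[K]_q) :
  ae_rep T u v -> ae_rep T (fun t => M *m u t) (fun t => M *m v t).
Proof.
move=> [hu hv uv]; split; [exact: meas_vec_mulmx|exact: bddmeas_vec_mulmx|].
apply: filterS uv; first exact: (ae_filter_ringOfSetsType mu).
by move=> t h tT; rewrite h.
Qed.

Lemma ae_repD q T (u v u' v' : K -> 'cV[K]_q) : ae_rep T u v -> ae_rep T u' v' ->
  ae_rep T (fun t => u t + u' t) (fun t => v t + v' t).
Proof.
move=> [hu hv uv] [hu' hv' uv']; split; [exact: meas_vecD|exact: bddmeas_vecD|].
have FF := ae_filter_ringOfSetsType mu.
by apply: filterS2 uv uv' => t h h' tT; rewrite h// h'.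
Qed.

Lemma ae_repZ q T a (u v : K -> 'cV[K]_q) : ae_rep T u v ->
  ae_rep T (fun t => a *: u t) (fun t => a *: v t).
Proof.
move=> /(ae_rep_mulmx a%:M); under eq_fun do rewrite mul_scalar_mx.
by under [in X in ae_rep _ _ X -> _]eq_fun do rewrite mul_scalar_mx.
Qed.

Lemma ae_rep_reflection q T (u v : K -> 'cV[K]_q) : ae_rep T u v ->
  ae_rep T (fun t => u (T - t)) (fun t => v (T - t)).
Proof.
move=> [hu hv uv]; split; last 1 first.
- apply: filterS (ae_reflection T uv); first exact: (ae_filter_ringOfSetsType mu).
  by move=> t /= h tT; apply: h; move: tT; rewrite !in_itv/=; lra.
- move=> i; apply: (@measurable_comp _ _ _ _ _ _ `[0, T] (fun t => u t i ord0) _ (fun t => T - t)) => //.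
    by move=> _ [t + <-]; rewrite /= !in_itv/=; lra.
  by apply: measurable_funTS; exact: measurable_reflection.
- exact: bddmeas_vec_reflection.
Qed.

Lemma ae_rep_convop p q T (H : K -> 'M[K]_(p, q)) D (u v : K -> 'cV[K]_q) :
  kernel_continuous H -> ae_rep T u v -> ae_rep T (convop H D u) (convop H D v).
Proof.
move=> cH [hu hv uv]; have E t (tT : t \in `[0, T]) := convop_ae_eq D cH hu hv uv tT.
split; [|exact: bddmeas_convop|].
- move=> i; have bG := bddmeas_convop D cH hv.
  have h : meas_vec T (fun t => convop H D v t + (D *m u t - D *m v t)).
    apply: meas_vecD; first exact: bddmeas_meas_vec.
    apply: meas_vecB; first exact: meas_vec_mulmx.
    by apply: meas_vec_mulmx; exact: bddmeas_meas_vec.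
  apply: eq_measurable_fun (h i) => t; rewrite inE/= => tT.
  by rewrite (E t tT) mulmxBr.
- apply: filterS uv; first exact: (ae_filter_ringOfSetsType mu).
  by move=> t h tT; rewrite (E t tT) (h tT) subrr mulmx0 addr0.
Qed.

Lemma ae_mrestrP T (P : K -> Prop) :
  {ae mrestr mu (measurable_itv `[0, T]), forall t, P t} <->
  {ae mu, forall t, t \in `[0, T] -> P t}.
Proof.
have mI : measurable (`[0, T] : set (measurableTypeR K)) by exact: measurable_itv.
split=> [[N [mN N0 PN]]|[N [mN N0 PN]]].
  exists (N `&` `[0, T]); split => //; first exact: measurableI.
  move=> t /= h; have [tT nP] : t \in `[0, T] /\ ~ P t by apply/not_implyP.
  by split => //; exact: PN.
exists (N `|` ~` `[0, T]); split.
- by apply: measurableU => //; exact: measurableC.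
- rewrite /mrestr setIUl setICl setU0.
  apply: (@subset_measure0 _ _ _ mu _ N) => //; first exact: measurableI.
- move=> t /= nP; have [tT|tT] := boolP (t \in `[0, T]); [left|right].
    by apply: PN => /= h; apply: nP; exact: h.
  by move=> /= h; rewrite h in tT.
Qed.

(** Clamp each coordinate at the essential bound. *)
Lemma Linf_ae_rep q T (u : K -> 'cV[K]_q) : Linf T u -> exists v, ae_rep T u v.
Proof.
move=> [hu /ess_supr_bounded[M /ae_mrestrP uM]].
(* A coordinate already within the bound is left unchanged. *)
pose v t : 'cV[K]_q := \col_i Num.max (- M) (Num.min (u t i ord0) M).
exists v; split => //.
  move=> i; under eq_fun do rewrite mxE; split.
    apply: measurable_maxr; first exact: measurable_cst.
    by apply: measurable_minr => //; exact: measurable_cst.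
  exists `|M| => t _; rewrite ler_norml; apply/andP; split.
    by rewrite le_max lerN2 ler_norm.
  by rewrite ge_max ge_min ler_norm orbT andbT -normrN ler_norm.
apply: filterS uM; first exact: (ae_filter_ringOfSetsType mu).
move=> t h tT; apply/colP => i; rewrite mxE.
have := le_trans (mx_norm_entry _ i ord0) (h tT); rewrite ler_norml => /andP[h1 h2].
by rewrite min_l// max_r.
Qed.

Lemma Linf_norm_le q T (u : K -> 'cV[K]_q) c :
  {ae mu, forall t, t \in `[0, T] -> `|u t| <= c} -> (Linf_norm T u <= c%:E)%E.
Proof. by move=> h; apply/ess_supP/ae_mrestrP. Qed.

Lemma Linf_norm_ge0 q T (u : K -> 'cV[K]_q) : 0 < T -> (0 <= Linf_norm T u)%E.
Proof.
move=> T0; apply: ess_sup_ger; last by move=> t; rewrite lee_fin.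
by rewrite /= /mrestr setTI [X in (_ < X)%E]lebesgue_measure_itv/= lte_fin T0 -EFinB lte_fin subr0.
Qed.

Lemma bddmeas_Linf q T (u : K -> 'cV[K]_q) : bddmeas_vec T u -> Linf T u.
Proof.
move=> bu; split; first exact: bddmeas_meas_vec.
have [c _ hc] := bddmeas_vec_bounded bu.
by apply: (le_lt_trans (Linf_norm_le (c := c) _)); [exact: aeW|exact: ltry].
Qed.
End Representatives.

(** * Gains, signature matrices and quadratic forms *)
Section Gain.
Context {K : realType}.
Local Notation mu := (@lebesgue_measure K).

Lemma mxnorm_inf_ge0 p q (M : 'M[K]_(p, q)) : 0 <= mxnorm_inf M.
Proof. exact: bigmax_ge_id. Qed.

Lemma mxnorm_inf_mulmx p q (M : 'M[K]_(p, q)) (v : 'cV[K]_q) :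
  `|M *m v| <= mxnorm_inf M * `|v|.
Proof.
apply/mx_norm_leP => [|i j]; first by rewrite mulr_ge0// mxnorm_inf_ge0.
rewrite mxE (le_trans (ler_norm_sum _ _ _))//.
apply: (@le_trans _ _ ((\sum_l `|M i l|) * `|v|)).
  by rewrite mulr_suml; apply: ler_sum => l _; rewrite normrM ler_wpM2l// mx_norm_entry.
by rewrite ler_wpM2r// /mxnorm_inf (le_bigmax _ (fun i => \sum_j `|M i j|)).
Qed.

Lemma mxnorm_infN p q (M : 'M[K]_(p, q)) : mxnorm_inf (- M) = mxnorm_inf M.
Proof.
by apply: eq_bigr => i _; apply: eq_bigr => j _; rewrite mxE normrN.
Qed.

Lemma peak_gain_rows n m (A : 'M[K]_n) (B : 'M[K]_(n, m)) (C : 'M[K]_(m, n)) (D : 'M[K]_m) T :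
  (peak_gain A B C D < +oo)%E ->
  exists2 g, 0 <= g & peak_gain A B C D = g%:E /\
    forall i, \sum_j (`|D i j| +
      \int[mu]_(s in `[0, T]) `|(C *m expmx (s *: A) *m B) i j|) <= g.
Proof.
move=> fin; set H := fun s => C *m expmx (s *: A) *m B.
have cH : kernel_continuous H by exact: kernel_continuous_impulse.
have ge0 : (0 <= peak_gain A B C D)%E.
  exact: bigmax_ge_id.
have gE : peak_gain A B C D = (fine (peak_gain A B C D))%:E.
  by rewrite fineK// ge0_fin_numE.
exists (fine (peak_gain A B C D)); first exact: fine_ge0.
split=> // i; rewrite -lee_fin -gE.
apply: (@le_trans _ _ (\sum_(j < m) (`|D i j|%:E +
   \int[mu]_(t in `[0%R, +oo[) `|(H t) i j|%:E)%E)%E); last first.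
  rewrite /peak_gain; exact: (le_bigmax _ (fun i => (\sum_(j < m) (`|D i j|%:E +
   \int[mu]_(t in `[0%R, +oo[) `|(H t) i j|%:E)))%E).
rewrite -sumEFin; apply: lee_sum => j _; rewrite EFinD leeD//.
have bH : bddmeas 0 T (fun s => `|H s i j|).
  by apply/bddmeas_norm/bddmeas_continuous; exact: cH.
rewrite /Rintegral fineK; last exact/integrable_fin_num/bddmeas_integrable.
apply: ge0_subset_integral => //.
  apply/measurable_EFinP/measurable_funTS; apply: measurableT_comp => //.
  by apply: continuous_measurable_fun; exact: cH.
by apply: subset_itvl; rewrite bnd_simp.
Qed.

Lemma signature_mxK m (S : 'M[K]_m) : signature_mx S -> S *m S = 1%:M.
Proof.
move=> [/is_diag_mxP dS sS]; apply/matrixP => i j; rewrite !mxE (bigD1 i)//= big1 ?addr0.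
  have [<-|ij] := eqVneq i j; last by rewrite (dS i j)// mulr0.
  by case: (sS i) => ->; rewrite ?mulrNN mulr1.
by move=> l li; rewrite (dS i l) ?mul0r// eq_sym.
Qed.

Lemma signature_conj_norm m (S M : 'M[K]_m) i j : signature_mx S ->
  `|(S *m M *m S) i j| = `|M i j|.
Proof.
move=> [/is_diag_mxP dS sS]; have sn l : `|S l l| = 1.
  by case: (sS l) => ->; rewrite ?normrN normr1.
rewrite mxE (bigD1 j)//= big1 ?addr0; last by move=> l lj; rewrite (dS l j) ?mulr0.
rewrite mxE (bigD1 i)//= big1 ?addr0; last by move=> l li; rewrite (dS i l) ?mul0r// eq_sym.
by rewrite !normrM !sn mul1r mulr1.
Qed.

End Gain.

Section QuadForm.
Context {K : realType} {m : nat}.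
Implicit Types (M : 'M[K]_m) (v w : 'cV[K]_m).

Lemma quad_formE M v : quad_form M v = dot v (M *m v).
Proof. by rewrite /quad_form /dot mulmxA. Qed.

Lemma quad_formD M v w : M^T = M ->
  quad_form M (v + w) = quad_form M v + quad_form M w + 2 * dot w (M *m v).
Proof.
move=> sM; rewrite !quad_formE mulmxDr dotDl !dotDr (dot_mulmx M v w) sM (dotC (M *m v)).
ring.
Qed.

Lemma pos_def_unitmx M : pos_def_mx M -> M \in unitmx.
Proof.
move=> [sM pM]; rewrite -row_free_unit -kermx_eq0; apply/eqP/row_matrixP => i.
rewrite row0; apply/eqP; rewrite -trmx_eq0; apply/negP => /negP/pM.
set k := row i (kermx M); rewrite /quad_form trmxK.
have -> : k *m M = 0 by rewrite -row_mul mulmx_ker row0.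
by rewrite mul0mx mxE ltxx.
Qed.
End QuadForm.

(** * The fixed point is the optimal input *)
Section OptimalControl.
Context {K : realType} {n m : nat}.
Local Notation mu := (@lebesgue_measure K).
Variables (A : 'M[K]_n) (B : 'M[K]_(n, m)) (C : 'M[K]_(m, n)) (D : 'M[K]_m).
Variables (Se Q R : 'M[K]_m) (T : K) (x0 : 'cV[K]_n).
Hypotheses (hSe : signature_mx Se) (hsym : externally_symmetric A B C D Se).
Hypotheses (hQ : pos_semidef_mx Q) (hR : pos_def_mx R) (T0 : 0 < T).

Let H : K -> 'M[K]_m := fun t => C *m expmx (t *: A) *m B.
Let G := io_operator A B C D.
Let F := fixpoint_operator A B C D T Q R Se x0.
Let output (u : K -> 'cV[K]_m) t := G u t + free_response A C x0 t.

Let Gadj (w : K -> 'cV[K]_m) t :=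
  convop (fun s => (H s)^T) D^T (fun r => w (T - r)) (T - t).

Let cH : kernel_continuous H.
Proof. exact: kernel_continuous_impulse. Qed.

Let cHt : kernel_continuous (fun s => (H s)^T).
Proof. by move=> i j; under eq_fun do rewrite mxE; exact: cH. Qed.

Let in_reflect t : t \in `[0, T] -> T - t \in `[0, T].
Proof. by rewrite !in_itv/=; lra. Qed.

Let bddmeas_free_response : bddmeas_vec T (free_response A C x0).
Proof.
move=> i; rewrite /free_response.
have cE := @continuous_expmx K n A.
rewrite (_ : (fun t => _) = fun t => \sum_l (\sum_p C i p * expmx (t *: A) p l) * x0 l ord0).
  apply: bddmeas_sum => l; apply: bddmeasM; last exact: bddmeas_cst.
  apply: bddmeas_sum => p; apply: bddmeasZ.
  by apply: bddmeas_continuous; exact: cE.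
by apply/funext => t; rewrite mxE; apply: eq_bigr => l _; rewrite mxE.
Qed.

Let bddmeas_G u : bddmeas_vec T u -> bddmeas_vec T (G u).
Proof. exact: (bddmeas_convop D cH). Qed.

Let bddmeas_output u : bddmeas_vec T u -> bddmeas_vec T (output u).
Proof. by move=> bu; apply: bddmeas_vecD => //; exact: bddmeas_G. Qed.

Let kernel_trE t : (H t)^T = Se *m H t *m Se.
Proof.
rewrite -mulmxA -(externally_symmetric_kernel hsym t) mulmxA (signature_mxK hSe).
by rewrite mul1mx.
Qed.

Let feedthrough_trE : D^T = Se *m D *m Se.
Proof.
rewrite -mulmxA -(externally_symmetric_feedthrough hsym) mulmxA (signature_mxK hSe).
by rewrite mul1mx.
Qed.

Let bddmeas_Gadj w : bddmeas_vec T w -> bddmeas_vec T (Gadj w).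
Proof.
move=> bw; apply: (@bddmeas_vec_reflection _ _ _ (convop _ _ _)).
exact/bddmeas_convop/bddmeas_vec_reflection.
Qed.

(** The conjugations by [Se] around the second application of the system turn its
    kernel into the transposed one ([kernel_trE]). *)
Lemma fixpoint_operator_adjoint u t : bddmeas_vec T u -> t \in `[0, T] ->
  F u t = - invmx R *m Gadj (fun r => Q *m output u r) t.
Proof.
move=> bu tT; rewrite /F /fixpoint_operator /pointwise_mul /time_reversal.
congr (_ *m _).
pose z r := Q *m output u (T - r).
have bz : bddmeas_vec T z.
  by apply: bddmeas_vec_mulmx; apply: bddmeas_vec_reflection; exact: bddmeas_output.
transitivity (Se *m convop H D (fun r => Se *m z r) (T - t)) => //.
rewrite (mulmx_convop Se D cH (bddmeas_vec_mulmx Se bz) (in_reflect tT)).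
rewrite /Gadj /convop mulmxA -feedthrough_trE; congr (_ + _).
congr mxintegral; apply/funext => r; rewrite mulmxA.
by rewrite -kernel_trE.
Qed.

Lemma bddmeas_fixpoint_operator u : bddmeas_vec T u -> bddmeas_vec T (F u).
Proof.
move=> bu; apply: (@eq_bddmeas_vec _ _ _ (fun t => - invmx R *m Gadj (fun r => Q *m output u r) t)).
  by move=> t tT; rewrite fixpoint_operator_adjoint.
apply: bddmeas_vec_mulmx; apply: bddmeas_Gadj.
by apply: bddmeas_vec_mulmx; exact: bddmeas_output.
Qed.

Lemma ae_rep_fixpoint_operator u v : ae_rep T u v -> ae_rep T (F u) (F v).
Proof.
move=> uv; apply: ae_rep_mulmx; apply: ae_rep_mulmx.
have yuv : ae_rep T (output u) (output v).
  by apply: ae_repD; [exact: (ae_rep_convop D cH uv)|exact: ae_rep_refl].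
have zuv := ae_rep_mulmx Se (ae_rep_mulmx Q (ae_rep_reflection yuv)).
exact: (ae_rep_reflection (ae_rep_convop D cH zuv)).
Qed.

(** Conjugation by a signature matrix only changes signs of entries, so the
    transposed kernel has the same row sums as the kernel itself and both
    convolutions cost a factor [g]. *)
Lemma fixpoint_operator_contraction g c u v t : 0 <= g ->
  (forall i, \sum_j (`|D i j| + \int[mu]_(s in `[0, T]) `|H s i j|) <= g) ->
  bddmeas_vec T u -> bddmeas_vec T v -> 0 <= c ->
  (forall t, t \in `[0, T] -> `|u t - v t| <= c) -> t \in `[0, T] ->
  `|F u t - F v t| <= mxnorm_inf Q * g ^+ 2 * mxnorm_inf (invmx R) * c.
Proof.
move=> g0 hg bu bv c0 uvc tT.
have hgt i : \sum_j (`|D^T i j| + \int[mu]_(s in `[0, T]) `|(H s)^T i j|) <= g.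
  apply: le_trans (hg i); rewrite le_eqVlt; apply/orP; left; apply/eqP.
  apply: eq_bigr => j _; rewrite feedthrough_trE (signature_conj_norm _ _ _ hSe).
  congr (_ + _); apply: eq_Rintegral => s _.
  by rewrite kernel_trE (signature_conj_norm _ _ _ hSe).
pose z u r := Q *m output u r.
have bz w : bddmeas_vec T w -> bddmeas_vec T (z w).
  by move=> bw; apply: bddmeas_vec_mulmx; exact: bddmeas_output.
have zB r : r \in `[0, T] -> `|z u r - z v r| <= mxnorm_inf Q * (g * c).
  move=> rT; rewrite -mulmxBr (le_trans (mxnorm_inf_mulmx _ _))//.
  rewrite ler_wpM2l ?mxnorm_inf_ge0// /output opprD addrACA subrr addr0.
  rewrite [X in `|X|](_ : _ = convop H D (fun s => u s - v s) r); last by rewrite (convopB D cH bu bv rT).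
  by apply: (convop_bound cH g0 c0 hg _ uvc rT); exact: bddmeas_vecB.
rewrite !fixpoint_operator_adjoint// -mulmxBr (le_trans (mxnorm_inf_mulmx _ _))//.
rewrite mxnorm_infN mulrC [leRHS](_ : _ = g * (mxnorm_inf Q * (g * c)) * mxnorm_inf (invmx R)); last by ring.
rewrite ler_wpM2r ?mxnorm_inf_ge0//.
have bzr w : bddmeas_vec T w -> bddmeas_vec T (fun r => z w (T - r)).
  by move=> bw; apply: (@bddmeas_vec_reflection _ _ _ (z w)); exact: bz.
rewrite [X in `|X|](_ : _ = convop (fun s => (H s)^T) D^T (fun r => z u (T - r) - z v (T - r)) (T - t)).
  apply: (convop_bound cHt g0 _ hgt _ _ (in_reflect tT)).
  - by rewrite mulr_ge0 ?mxnorm_inf_ge0// mulr_ge0.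
  - by apply: bddmeas_vecB; exact: bzr.
  - by move=> s /in_reflect; exact: zB.
by rewrite (convopB D^T cHt (bzr _ bu) (bzr _ bv) (in_reflect tT)).
Qed.

(** The terms linear in [v - w] cancel: moving [G] to its adjoint turns them into
    the integral of [(v - w)' (R w + G^* Q y)], with [y] the output for [w], and this
    vector is 0 because [w] is a fixed point. *)
Lemma cost_expansion w v : bddmeas_vec T w -> bddmeas_vec T v ->
  {in `[0, T], F w =1 w} ->
  cost T Q R v (output v) = cost T Q R w (output w) +
  2^-1 * \int[mu]_(t in `[0, T]) (quad_form Q (G (fun s => v s - w s) t) + quad_form R (v t - w t)).
Proof.
move=> bw bv Fw; pose e := G (fun s => v s - w s); pose d s := v s - w s.
have bd : bddmeas_vec T d by exact: bddmeas_vecB.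
have be : bddmeas_vec T e by exact: bddmeas_G.
have byw := bddmeas_output bw; have byv := bddmeas_output bv.
pose a t := Q *m output w t.
have ba : bddmeas_vec T a by exact: bddmeas_vec_mulmx.
have bq M (u : K -> 'cV[K]_m) : bddmeas_vec T u -> bddmeas 0 T (fun t => quad_form M (u t)).
  move=> bu; under eq_fun do rewrite quad_formE.
  by apply: bddmeas_dot => //; exact: bddmeas_vec_mulmx.
have byE t : t \in `[0, T] -> output v t = output w t + e t.
  move=> tT; rewrite /output /e [X in _ = _ + X](convopB D cH bv bw tT).
  by rewrite [RHS]addrAC; congr (_ + _); rewrite addrC subrK.
have Rw t : t \in `[0, T] -> R *m w t = - Gadj a t.
  move=> tT; rewrite -Fw// fixpoint_operator_adjoint// mulmxA mulmxN mulmxV ?pos_def_unitmx//.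
  by rewrite mulNmx mul1mx.
pose cross t := dot (a t) (e t) - dot (Gadj a t) (d t).
have bcross1 : bddmeas 0 T (fun t => dot (a t) (e t)) by exact: bddmeas_dot.
have bcross2 : bddmeas 0 T (fun t => dot (Gadj a t) (d t)).
  by apply: bddmeas_dot => //; exact: bddmeas_Gadj.
have bcross : bddmeas 0 T cross.
  by apply: bddmeasD => //; under eq_fun do rewrite -mulN1r; exact: bddmeasZ.
have cross0 : \int[mu]_(t in `[0, T]) cross t = 0.
  rewrite RintegralB//; [|exact: bddmeas_integrable..].
  by rewrite [X in X - _](convop_adjoint D cH (ltW T0) bd ba) subrr.
have bw' : bddmeas 0 T (fun t => quad_form Q (output w t) + quad_form R (w t)).
  by apply: bddmeasD; exact: bq.
have bi : bddmeas 0 T (fun t => quad_form Q (e t) + quad_form R (d t)).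
  by apply: bddmeasD; exact: bq.
have E : \int[mu]_(t in `[0, T]) (quad_form Q (output v t) + quad_form R (v t)) =
  \int[mu]_(t in `[0, T]) ((quad_form Q (output w t) + quad_form R (w t)) +
     ((quad_form Q (e t) + quad_form R (d t)) + 2 * cross t)).
  apply: eq_Rintegral => t; rewrite inE/= => tT.
  have -> : v t = w t + d t by rewrite /d addrC subrK.
  rewrite byE// (quad_formD _ _ (proj1 hQ)) (quad_formD _ _ (proj1 hR)) Rw// dotNr.
  by rewrite /cross (dotC (e t)) (dotC (d t)); ring.
have b2c := bddmeasZ 2 bcross.
rewrite /cost E (RintegralD _ (bddmeas_integrable bw') (bddmeas_integrable (bddmeasD bi b2c)))//.
rewrite mulrDr; congr (_ + _); congr (_ * _).
rewrite (RintegralD _ (bddmeas_integrable bi) (bddmeas_integrable b2c))//.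
rewrite RintegralZl//; last exact: bddmeas_integrable.
by rewrite cross0 mulr0 addr0.
Qed.

Let quad_sum_ge0 (e d : 'cV[K]_m) : 0 <= quad_form Q e + quad_form R d.
Proof.
rewrite addr_ge0//; first exact: (proj2 hQ).
have [->|dn0] := eqVneq d 0; last by rewrite ltW// (proj2 hR).
by rewrite /quad_form mulmx0 mxE.
Qed.

(** The state cannot tell [v] from [w], hence neither can the output up to a null
    set; uniqueness of trajectories identifies the latter with [G w + d]. *)
Lemma trajectory_cost v w x y : ae_rep T v w -> trajectory A B C D T x0 v x y ->
  cost T Q R v y = cost T Q R w (output w).
Proof.
move=> [hv bw vw] [cx ix yx].
have bx : bddmeas_vec T x.
  by move=> i; apply: bddmeas_within; exact: within_continuous_entry.
have mx := bddmeas_meas_vec bx; have mw := bddmeas_meas_vec bw.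
have traj : trajectory A B C D T x0 w x (fun t => C *m x t + D *m w t).
  split => // t tT; rewrite ix//; congr (_ + _); apply/matrixP => i j; rewrite !mxE.
  have [_ tT'] := andP tT; rewrite /= in tT'.
  have sub : `[0, t] `<=` `[0, T] by apply: subset_itv; rewrite bnd_simp.
  have M u : meas_vec T u -> measurable_fun `[0, t] (fun r => (A *m x r + B *m u r) i j).
    move=> hu; rewrite (ord1 j); apply: (measurable_funS _ sub); first exact: measurable_itv.
    exact: (meas_vecD (meas_vec_mulmx A mx) (meas_vec_mulmx B hu) i).
  apply: ae_eq_Rintegral; [exact: M|exact: M|].
  apply: filterS vw; first exact: (ae_filter_ringOfSetsType mu).
  by move=> r h rt; rewrite h//; exact: sub.
have response := trajectory_response A B C D x0 bw (ltW T0).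
have xE := trajectory_unique bw (ltW T0) traj response.
have yE t : t \in `[0, T] -> y t = output w t + D *m (v t - w t).
  move=> tT; have [_ _ /(_ t tT) yw] := response.
  have -> : output w t = C *m x t + D *m w t by rewrite xE.
  by rewrite yx// mulmxBr addrA addrAC addrK.
have myw := bddmeas_meas_vec (bddmeas_output bw).
have my : meas_vec T y.
  move=> i; have h := meas_vecD myw (meas_vec_mulmx D (meas_vecB hv mw)).
  by apply: eq_measurable_fun (h i) => t; rewrite inE/= => tT; rewrite yE.
have mq M u : meas_vec T u -> measurable_fun `[0, T] (fun t => quad_form M (u t)).
  move=> hu; under [X in measurable_fun _ X]eq_fun do rewrite quad_formE.
  by apply: measurable_dot => //; exact: meas_vec_mulmx.
congr (_ * _); apply: ae_eq_Rintegral.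
- by apply: measurable_funD; exact: mq.
- by apply: measurable_funD; exact: mq.
- apply: filterS vw; first exact: (ae_filter_ringOfSetsType mu).
  by move=> t h tT; rewrite yE// h// subrr mulmx0 addr0.
Qed.

Section AtFixedPoint.
Variable w : K -> 'cV[K]_m.
Hypotheses (bw : bddmeas_vec T w) (Fw : {in `[0, T], F w =1 w}).

Lemma fixed_point_optimal : optimal A B C D T Q R x0 w.
Proof.
split; first exact: bddmeas_Linf.
exists (state_response A B x0 w), (io_operator A B C D w \+ free_response A C x0).
split; first exact: (trajectory_response _ _ _ _ _ bw (ltW T0)).
move=> v xv yv /Linf_ae_rep[v' vv'] /(trajectory_cost vv') ->.
have [_ bv' _] := vv'; rewrite (cost_expansion bw bv' Fw) lerDl mulr_ge0 ?invr_ge0//.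
by apply: Rintegral_ge0 => t _; exact: quad_sum_ge0.
Qed.

(** At equal cost, the nonnegative remainder of [cost_expansion] integrates to 0,
    so it vanishes a.e., and [R] is positive definite. *)
Lemma optimal_ae_fixed_point v : optimal A B C D T Q R x0 v ->
  {ae mu, forall t, t \in `[0, T] -> v t = w t}.
Proof.
move=> [Lv [x [y [traj opt]]]].
have [v' vv'] := Linf_ae_rep Lv; have [_ bv' v_v'] := vv'.
have le0 : cost T Q R v y <= cost T Q R w (output w).
  exact: opt (bddmeas_Linf bw) (trajectory_response A B C D x0 bw (ltW T0)).
pose g t := quad_form Q (G (fun s => v' s - w s) t) + quad_form R (v' t - w t).
rewrite (trajectory_cost vv' traj) (cost_expansion bw bv' Fw) in le0.
have bg : bddmeas 0 T g.
  have bq M (u : K -> 'cV[K]_m) : bddmeas_vec T u -> bddmeas 0 T (fun t => quad_form M (u t)).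
    move=> bu; under eq_fun do rewrite quad_formE.
    by apply: bddmeas_dot => //; exact: bddmeas_vec_mulmx.
  by apply: bddmeasD; apply: bq; [apply: bddmeas_G|]; exact: bddmeas_vecB.
have g0 t : 0 <= g t by exact: quad_sum_ge0.
have ig0 : \int[mu]_(t in `[0, T]) g t = 0.
  apply/eqP; rewrite eq_le Rintegral_ge0// andbT.
  by move: le0; rewrite gerDl pmulr_rle0// invr_gt0.
have : ae_eq mu `[0, T]%classic (EFin \o g) (cst 0%E).
  apply/ae_eq_integral_abs => //; first by apply/measurable_EFinP; have [] := bg.
  under eq_integral do rewrite /= ger0_norm//.
  rewrite -(fineK (integrable_fin_num _ (bddmeas_integrable bg)))//.
  by rewrite -[fine _]/(Rintegral mu _ g) ig0.
have FF := ae_filter_ringOfSetsType mu.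
move=> gae; apply: filterS2 v_v' gae => t vt gt tT; rewrite vt//.
have [gt0] := gt tT.
apply/eqP; rewrite -subr_eq0; apply/negPn/negP => /(proj2 hR).
rewrite ltNge; move/negP; apply.
by rewrite -gt0 /g lerDr (proj2 hQ).
Qed.

Lemma relaxed_iterate_ae_rep alpha u v k : ae_rep T u v ->
  ae_rep T (relaxed_iterate A B C D T Q R Se x0 alpha u k)
           (relaxed_iterate A B C D T Q R Se x0 alpha v k).
Proof.
move=> uv; elim: k => [//|k IH].
by apply: ae_repD; apply: ae_repZ => //; exact: ae_rep_fixpoint_operator.
Qed.

(** One relaxed step maps [v - w] to the convex combination of [v - w] and
    [F v - F w]. *)
Lemma relaxed_iterate_bound g alpha c v k t : 0 <= g ->
  (forall i, \sum_j (`|D i j| + \int[mu]_(s in `[0, T]) `|H s i j|) <= g) ->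
  0 <= alpha <= 1 -> bddmeas_vec T v -> 0 <= c ->
  (forall t, t \in `[0, T] -> `|v t - w t| <= c) -> t \in `[0, T] ->
  `|relaxed_iterate A B C D T Q R Se x0 alpha v k t - w t| <=
    c * (1 - alpha + alpha * (mxnorm_inf Q * g ^+ 2 * mxnorm_inf (invmx R))) ^+ k.
Proof.
move=> g0 hg /andP[a0 a1] bv c0 vw; set q := mxnorm_inf Q * _ * _; set rho := _ + _ * q.
have q0 : 0 <= q by rewrite !mulr_ge0 ?exprn_ge0 ?mxnorm_inf_ge0.
have r0 : 0 <= rho by apply: addr_ge0; [rewrite subr_ge0|exact: mulr_ge0].
have bit j : bddmeas_vec T (relaxed_iterate A B C D T Q R Se x0 alpha v j).
  by have [] := relaxed_iterate_ae_rep alpha j (ae_rep_refl bv).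
elim: k t => [|k IH] t tT; first by rewrite expr0 mulr1 vw.
rewrite /relaxed_iterate iterS -/(relaxed_iterate A B C D T Q R Se x0 alpha v k).
set x := relaxed_iterate _ _ _ _ _ _ _ _ _ _ _ k.
have -> : (1 - alpha) *: x t + alpha *: F x t - w t =
    (1 - alpha) *: (x t - w t) + alpha *: (F x t - F w t).
  rewrite Fw// !scalerBr addrACA; congr (_ + _).
  by rewrite -opprD -scalerDl subrK scale1r.
rewrite (le_trans (ler_normD _ _))// !normrZ [X in X * _ + _]ger0_norm ?subr_ge0//.
rewrite [X in _ + X * _]ger0_norm// exprS mulrCA {1}/rho [leRHS]mulrDl lerD//.
  by rewrite ler_wpM2l ?subr_ge0//; exact: IH.
rewrite -mulrA ler_wpM2l//; apply: fixpoint_operator_contraction => //.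
- exact: bit.
- by rewrite mulr_ge0// exprn_ge0.
Qed.
End AtFixedPoint.
End OptimalControl.

Theorem lemma3 (K : realType) (n m : nat)
    (A : 'M[K]_n) (B : 'M[K]_(n, m)) (C : 'M[K]_(m, n)) (D : 'M[K]_m)
    (Se Q R : 'M[K]_m) (tf : K) (x0 : 'cV[K]_n) (u0 : K -> 'cV[K]_m)
    (hSe : signature_mx Se)
    (hsym : externally_symmetric A B C D Se)
    (hQ : pos_semidef_mx Q)
    (hR : pos_def_mx R)
    (htf : 0 < tf)
    (hu0 : Linf tf u0)
    (hG : (peak_gain A B C D < +oo)%E)
    (hgain : ((mxnorm_inf Q)%:E * peak_gain A B C D ^+ 2 *
              (mxnorm_inf (invmx R))%:E < 1)%E) :
  exists ustar : K -> 'cV[K]_m,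
    [/\ optimal A B C D tf Q R x0 ustar,
        (forall v, optimal A B C D tf Q R x0 v ->
           {ae lebesgue_measure, forall t, t \in `[0, tf] -> v t = ustar t})
      & forall alpha : K, 0 < alpha <= 1 ->
          Linf_norm tf (relaxed_iterate A B C D tf Q R Se x0 alpha u0 k
                          \- ustar) @[k --> \oo] --> 0%E].
Proof.
have [g g0 [gE hg]] := peak_gain_rows tf hG.
rewrite gE -EFin_expe -!EFinM lte_fin in hgain.
set q := _ * _ * _ in hgain.
have q0 : 0 <= q by rewrite !mulr_ge0 ?exprn_ge0 ?mxnorm_inf_ge0.
have [w bw Fw] : exists2 w, bddmeas_vec tf w &
    {in `[0, tf], fixpoint_operator A B C D tf Q R Se x0 w =1 w}.
  apply: (@contraction_fixed_point _ _ _ _ q); first by rewrite q0.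
    by move=> u bu; exact: bddmeas_fixpoint_operator.
  by move=> u v c bu bv c0 uv t tT; exact: fixpoint_operator_contraction.
exists w; split.
- exact: (fixed_point_optimal hSe hsym hQ hR htf bw Fw).
- exact: (optimal_ae_fixed_point hSe hsym hQ hR htf bw Fw).
move=> alpha /andP[a0 a1].
(* The bound [relaxed_iterate_bound] is applied to the iterates started from the
   representative [v] of [u0]; they agree a.e. with those started from [u0]. *)
have [v u0v] := Linf_ae_rep hu0; have [_ bv _] := u0v.
have [c c0 hc] := bddmeas_vec_bounded (bddmeas_vecB bv bw).
pose rho := 1 - alpha + alpha * q.
have r0 : 0 <= rho by apply: addr_ge0; [rewrite subr_ge0|rewrite mulr_ge0// ltW].
have r1 : rho < 1 by rewrite /rho; nra.
apply: (@squeeze_cvge _ _ _ _ (cst 0%E) _ (fun k => (c * rho ^+ k)%:E)).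
- apply: nearW => k; rewrite Linf_norm_ge0//=.
  have [_ _ uv] := relaxed_iterate_ae_rep A B C D Se Q R x0 alpha k u0v.
  apply: Linf_norm_le; apply: filterS uv; first exact: (ae_filter_ringOfSetsType lebesgue_measure).
  move=> t h tT; rewrite /= h//.
  have a01 : 0 <= alpha <= 1 by rewrite ltW.
  exact: (relaxed_iterate_bound hSe hsym bw Fw k g0 hg a01 bv c0 hc tT).
- exact: cvg_cst.
- by apply/fine_cvgP; split; [exact: nearW|apply: cvg_geometric; rewrite ger0_norm].
Qed.
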